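(* If $d\ge3$, then $$\Lambda^*(\mathrm{Id}_d)-\|\mathrm{Id}_d\|^2\ge(d-1)^2-d,$$ where $\mathrm{Id}_d$ is the $d\times d$ identity matrix.
   Context: For a real $k\times d$ matrix $A=(a_{i,j})$, $\|A\|^2=\sum_{i,j}a_{i,j}^2$. For an open set $D\subset\mathbb{R}^d$, $\Lambda\ge0$ and $W\in H^1(D;\mathbb{R}^k)$, let $\Omega_W:=\{W\ne0\}$ and $J_\Lambda(W,D):=\int_D|\nabla W|^2\,dx+\Lambda|\Omega_W\cap D|$, where $|\cdot|$ of a set is Lebesgue measure. A function $U\in H^1(D,\mathbb{R}^k)$ is a minimizer of $J_\Lambda$ in $D$ if $J_\Lambda(U,D)\le J_\Lambda(W,D)$ for every $W\in H^1_{loc}(D,\mathbb{R}^k)$ with $W-U\in H^1_0(D,\mathbb{R}^k)$. A function $U\in H^1_{loc}(\mathbb{R}^d,\mathbb{R}^k)$ is a global minimizer of $J_\Lambda$ if for every $R>0$ it is a minimizer of $J_\Lambda$ in $B_R$ (the ball of radius $R$ centered at $0$). For a real $k\times d$ matrix $A$, $\Lambda^*(A):=\sup\{\Lambda>0:\ x\mapsto Ax\text{ is a global minimizer of }J_\Lambda\}$ (here $k=d$ for $A=\mathrm{Id}_d$). *)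

(* Defs.v *)
From HB Require Import structures.
From mathcomp Require Import all_boot all_order all_algebra.
From mathcomp Require Import all_classical all_reals all_analysis.

Set Implicit Arguments.
Unset Strict Implicit.
Unset Printing Implicit Defensive.

Import Order.TTheory GRing.Theory Num.Theory.
Import numFieldNormedType.Exports.

Local Open Scope classical_set_scope.
Local Open Scope ring_scope.

(* R^d is 'cV[R]_d with its usual topology. The norm that the library puts on *)
(* matrices is the sup norm, so Euclidean norms are written with norm2 below. *)

(* The sigma-algebra generated by the entries: on 'cV[R]_d, this is the       *)
(* product (hence Borel) sigma-algebra of R^d.                                *)
Section measurable_matrix.
Context {d : measure_display} {T : measurableType d}.
Variables m n : nat.

Definition mx_cylinders : set (set 'M[T]_(m, n)) :=
  [set A | exists (i : 'I_m) (j : 'I_n), exists2 B : set T,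
     measurable B & A = [set M : 'M[T]_(m, n) | B (M i j)]].

Let mx_set0 : <<s mx_cylinders >> set0.
Proof. exact: sigma_algebra0. Qed.

Let mx_setC A : <<s mx_cylinders >> A -> <<s mx_cylinders >> (~` A).
Proof. exact: sigma_algebraC. Qed.

Let mx_bigcup (F : (set 'M[T]_(m, n))^nat) :
  (forall i, <<s mx_cylinders >> (F i)) ->
  <<s mx_cylinders >> (\bigcup_i (F i)).
Proof. exact: sigma_algebra_bigcup. Qed.

HB.instance Definition _ := @isMeasurable.Build (sigma_display mx_cylinders)
  'M[T]_(m, n) <<s mx_cylinders >> mx_set0 mx_setC mx_bigcup.

End measurable_matrix.

Lemma measurable_mxentry (d : measure_display) (T : measurableType d)
    (m n : nat) (i : 'I_m) (j : 'I_n) :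
  measurable_fun [set: 'M[T]_(m, n)] (fun M : 'M[T]_(m, n) => M i j).
Proof.
move=> _ B mB; rewrite setTI; apply: sub_sigma_algebra => /=.
by exists i, j, B.
Qed.

Lemma measurable_fun_mx (d1 d2 : measure_display) (T1 : measurableType d1)
    (T2 : measurableType d2) (m n : nat) (f : T1 -> 'M[T2]_(m, n)) :
  (forall i j, measurable_fun [set: T1] (fun x => f x i j)) ->
  measurable_fun [set: T1] f.
Proof.
move=> mf.
apply: (@measurability _ _ _ _ setT f (@mx_cylinders _ T2 m n)) => //.
by move=> _ [_ [i [j [B mB ->]]] <-]; exact: mf.
Qed.

Section lebesgue_measure_cV.
Context {R : realType}.
Local Open Scope ereal_scope.

Definition cons_cV (n : nat) (p : 'cV[R]_n * R) : 'cV[R]_n.+1 :=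
  col_mx (p.2)%:M p.1.

Lemma measurable_cons_cV (n : nat) : measurable_fun setT (@cons_cV n).
Proof.
apply: measurable_fun_mx => i j; rewrite ord1 => {j}.
case: (@split_ordP 1 n i) => k ->{i}.
  rewrite (_ : (fun _ => _) = snd); first exact: measurable_snd.
  apply/funext => p; rewrite /cons_cV.
  by apply: etrans (col_mxEu _ _ _ _) _; rewrite ord1 mxE eqxx mulr1n.
rewrite (_ : (fun _ => _) = (fun v : 'cV[R]_n => v k ord0) \o fst).
  by apply: measurableT_comp; [exact: measurable_mxentry|exact: measurable_fst].
by apply/funext => p; exact: col_mxEd.
Qed.

(* The product of a measure on R^n and the Lebesgue measure on R, transported *)
(* to R^(n+1).                                                                *)
Definition lebesgue_cVS (n : nat) (m : {measure set 'cV[R]_n -> \bar R}) :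
    set 'cV[R]_n.+1 -> \bar R :=
  pushforward (m \x (@lebesgue_measure R)) (@cons_cV n).

Section lebesgue_cVS_measure.
Variables (n : nat) (m : {measure set 'cV[R]_n -> \bar R}).

Let cVS0 : lebesgue_cVS m set0 = 0.
Proof. by rewrite /lebesgue_cVS /pushforward preimage_set0 measure0. Qed.

Let cVS_ge0 A : 0 <= lebesgue_cVS m A.
Proof. by rewrite /lebesgue_cVS /pushforward measure_ge0. Qed.

Let cVS_sigma_additive : semi_sigma_additive (lebesgue_cVS m).
Proof.
move=> F mF tF mUF; rewrite /lebesgue_cVS /pushforward preimage_bigcup.
have mcons A : measurable A -> measurable (@cons_cV n @^-1` A).
  by move=> mA; rewrite -[X in measurable X]setTI; exact: measurable_cons_cV.
apply: measure_semi_sigma_additive.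
- by move=> i; exact: mcons.
- apply/trivIsetP => i j _ _ ij; rewrite -preimage_setI.
  by move/trivIsetP : tF => /(_ _ _ _ _ ij) ->//; rewrite preimage_set0.
- by rewrite -preimage_bigcup; exact: mcons.
Qed.

HB.instance Definition _ := isMeasure.Build _ _ _
  (lebesgue_cVS m) cVS0 cVS_ge0 cVS_sigma_additive.

End lebesgue_cVS_measure.

Fixpoint lebesgue_cV (n : nat) : {measure set 'cV[R]_n -> \bar R} :=
  match n return {measure set 'cV[R]_n -> \bar R} with
  | 0 => dirac (0%R : 'cV[R]_0)
  | n'.+1 => lebesgue_cVS (lebesgue_cV n')
  end.

End lebesgue_measure_cV.

Section sobolev.
Context {R : realType} {d : nat}.
Implicit Types (D K : set 'cV[R]_d) (f g phi : 'cV[R]_d -> R).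

Local Notation mu := (@lebesgue_cV R d).

(* The squared Euclidean (Frobenius) norm. *)
Definition norm2 {m n : nat} (A : 'M[R]_(m, n)) : R :=
  \sum_(i < m) \sum_(j < n) A i j ^+ 2.

Definition Rd_ball (r : R) : set 'cV[R]_d := [set x | norm2 x < r ^+ 2].

Definition partial (j : 'I_d) phi : 'cV[R]_d -> R :=
  fun x => 'D_(delta_mx j 0) phi x.

Definition smooth phi : Prop := forall s : seq 'I_d,
  continuous (foldr partial phi s) /\
  forall (j : 'I_d) (x : 'cV[R]_d),
    derivable (foldr partial phi s) x (delta_mx j 0).

(* phi is in C_c^infty(D). *)
Definition test_function D phi : Prop :=
  [/\ smooth phi, compact (closure [set x | phi x != 0]) &
      closure [set x | phi x != 0] `<=` D].

Definition loc_integrable D f : Prop :=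
  measurable_fun D f /\ forall K, compact K -> K `<=` D ->
    (\int[mu]_(x in K) `|f x|%:E < +oo)%E.

(* g is the weak partial derivative of f on D in the j-th direction. *)
Definition weak_partial D (j : 'I_d) f g : Prop :=
  [/\ loc_integrable D f, loc_integrable D g &
      forall phi, test_function D phi ->
        (\int[mu]_(x in D) (f x * partial j phi x)%:E =
         - \int[mu]_(x in D) (g x * phi x)%:E)%E].

Section vector_valued.
Context {k : nat}.
Implicit Types U W : 'cV[R]_d -> 'cV[R]_k.

Definition is_weak_gradient D W (G : 'cV[R]_d -> 'M[R]_(k, d)) : Prop :=
  forall (i : 'I_k) (j : 'I_d),
    weak_partial D j (fun x => W x i 0) (fun x => G x i j).

(* A weak gradient of W on D (unique up to a null set), when there is one. *)
Definition weak_gradient D W : 'cV[R]_d -> 'M[R]_(k, d) :=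
  xget (fun=> 0) [set G | is_weak_gradient D W G].

Definition L2 {m n : nat} D (F : 'cV[R]_d -> 'M[R]_(m, n)) : Prop :=
  measurable_fun D F /\ (\int[mu]_(x in D) (norm2 (F x))%:E < +oo)%E.

Definition L2loc {m n : nat} D (F : 'cV[R]_d -> 'M[R]_(m, n)) : Prop :=
  forall K, compact K -> K `<=` D -> L2 K F.

Definition H1 D W : Prop :=
  L2 D W /\ exists2 G, is_weak_gradient D W G & L2 D G.

Definition H1loc D W : Prop :=
  L2loc D W /\ exists2 G, is_weak_gradient D W G & L2loc D G.

Definition H1norm2 D W : \bar R :=
  (\int[mu]_(x in D) (norm2 (W x))%:E +
   \int[mu]_(x in D) (norm2 (weak_gradient D W x))%:E)%E.

(* The closure of C_c^infty(D; R^k) in H^1(D; R^k). *)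
Definition H10 D W : Prop :=
  H1 D W /\ forall e : R, 0 < e ->
    exists2 Phi : 'cV[R]_d -> 'cV[R]_k,
      (forall i : 'I_k, test_function D (fun x => Phi x i 0)) &
      (H1norm2 D (fun x => Phi x - W x)%R < e%:E)%E.

Definition J (Lambda : R) W D : \bar R :=
  (\int[mu]_(x in D) (norm2 (weak_gradient D W x))%:E +
   Lambda%:E * mu ([set x | W x != 0%R] `&` D))%E.

Definition minimizer (Lambda : R) U D : Prop :=
  H1 D U /\
  forall W, H1loc D W -> H10 D (fun x => W x - U x) ->
    (J Lambda U D <= J Lambda W D)%E.

Definition global_minimizer (Lambda : R) U : Prop :=
  H1loc setT U /\ forall r : R, 0 < r -> minimizer Lambda U (Rd_ball r).

(* The supremum is taken in the extended reals: it is -oo when no Lambda > 0  *)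
(* is admissible, and +oo when they are unbounded.                            *)
Definition Lambda_star (A : 'M[R]_(k, d)) : \bar R :=
  ereal_sup [set Lambda%:E | Lambda in
    [set Lambda : R | 0 < Lambda /\
      global_minimizer Lambda (fun x => A *m x)]].

End vector_valued.
End sobolev.

(* Main.v *)
Require Import Defs.
From HB Require Import structures.
From mathcomp Require Import all_boot all_order all_algebra.
From mathcomp Require Import all_classical all_reals all_analysis.
From mathcomp Require Import measurable_realfun.
From mathcomp Require Import ring lra.

Set Implicit Arguments.
Unset Strict Implicit.
Unset Printing Implicit Defensive.

Import Order.TTheory GRing.Theory Num.Theory.
Import numFieldNormedType.Exports.

Local Open Scope classical_set_scope.
Local Open Scope ring_scope.

(** In dimension [n] the identity is a global minimizer for [Lambda = n ^ 2], so
    the threshold is at least [n ^ 2 >= (n - 1) ^ 2], while the squared norm of the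
    identity matrix is [n].

    Let [W = x + phi] with [phi] in [H^1_0 (D)], where [D] is bounded and open, and
    let [A] be the zero set of [W] in [D]. For a test field [phi] the divergence of
    [phi] integrates to 0, so the Dirichlet energy of [W] exceeds [n |D|], that of
    the identity, by the integral of [|grad phi| ^ 2]. This is at least the
    integral of [(div phi) ^ 2], since [d_i phi_j * d_j phi_i] and
    [d_i phi_i * d_j phi_j] have the same integral ([integral_partial_swap]) and
    the sum of the former over [i] and [j] is at most [|grad phi| ^ 2].
    As [div phi = div W - n], on [A] one has
    [(div phi) ^ 2 >= n ^ 2 - 2 * n * div W], whatever the value of [div W]. Hence
    [[
      (Dirichlet energy of W) - n |D| >= n ^ 2 |A| - 2 * n * (integral of div W over A)
    ]]
    ([energy_test_field], for an arbitrary measurable [A]). This passes to the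
    limit in [H^1] ([energy_ge], [energy_competitor]). The last integral is then 0, because the gradient of [W]
    vanishes on the zero set of [W], and [n ^ 2 |A|] is exactly what [W] may gain
    in the measure term.

    That [div W] integrates to 0 over [A] ([Rintegral_trace_zero_set]) is obtained
    by composing [W] with a map that is the identity to first order at the origin
    and has size at most [e]. Its Jacobian is bounded and tends to the indicator
    of the origin times the identity matrix as [e] tends to 0. The divergence of
    the composite has the same integral as for [phi = 0], because the two fields
    agree near the boundary ([tr_jac_balance]); for [phi = 0] the limit as [e]
    tends to 0 is [n |{0}| = 0].

    The energy is defined through one chosen weak gradient, so the argument also
    needs that weak gradients are unique up to null sets ([weak_gradient_ae]). This
    rests on smooth bumps that increase to the indicators of boxes and on the fact
    that boxes form a pi-system generating the Borel sets ([fundamental_lemma]). *)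

(** * Boxes, and the Borel structure of the space of column vectors *)

Section boxes.
Context {R : realType} {n : nat}.
Implicit Types (a b x y : 'cV[R]_n) (A : set 'cV[R]_n).

Definition box a b : set 'cV[R]_n := [set x | forall i, a i 0 < x i 0 < b i 0].

Definition cbox a b : set 'cV[R]_n := [set x | forall i, a i 0 <= x i 0 <= b i 0].

Lemma box_cbox a b : box a b `<=` cbox a b.
Proof. by move=> x abx i; have /andP[ax xb] := abx i; rewrite !ltW. Qed.

Lemma coord_cV_continuous (i : 'I_n) : continuous (fun x : 'cV[R]_n => x i 0).
Proof. by move=> x; exact: coord_continuous. Qed.

Lemma cV_norm_le x (e : R) : 0 <= e -> (forall i, `|x i 0| <= e) -> `|x| <= e.
Proof.
move=> e0 xe; rewrite {1}/Num.Def.normr /= mx_normrE; apply: bigmax_le => // -[i j] _ /=.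
by rewrite ord1.
Qed.

Lemma le_coord_cV_norm x i : `|x i 0| <= `|x|.
Proof.
rewrite {2}/Num.Def.normr /= mx_normrE.
by apply: le_trans (le_bigmax _ _ (i, 0)).
Qed.

Lemma measurable_box a b : measurable (box a b).
Proof.
rewrite (_ : box a b = \bigcap_(i in [set: 'I_n])
    ((fun x : 'cV[R]_n => x i 0) @^-1` `]a i 0, b i 0[)); last first.
  apply/seteqP; split => x /= abx i.
    by move=> _; rewrite /= in_itv/=; exact: abx.
  by have := abx i Logic.I; rewrite /= in_itv.
apply: fin_bigcap_measurable => // i _.
by rewrite -[X in measurable X]setTI; exact: measurable_mxentry.
Qed.

Lemma closed_cbox a b : closed (cbox a b).
Proof.
rewrite (_ : cbox a b = \bigcap_(i in [set: 'I_n])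
    ((fun x : 'cV[R]_n => x i 0) @^-1` `[a i 0, b i 0])); last first.
  apply/seteqP; split => x /= abx i.
    by move=> _; rewrite /= in_itv/=; exact: abx.
  by have := abx i Logic.I; rewrite /= in_itv.
apply: closed_bigI => i _; apply: closed_comp => [x _|].
  exact: coord_cV_continuous.
exact: itv_closed.
Qed.

Lemma trmx_continuous : continuous (@trmx R 1 n).
Proof.
move=> /= x A /= -[P Px PA]; exists (fun i j => P j i).
  by move=> i j; have := Px j i; rewrite mxE.
by move=> y Py; apply: PA => i j; rewrite mxE; exact: Py.
Qed.

Lemma compact_cbox a b : compact (cbox a b).
Proof.
rewrite (_ : cbox a b =
    @trmx R 1 n @` [set v : 'rV[R]_n | forall i, `[a i 0, b i 0]%classic (v ord0 i)]).
  apply: continuous_compact; first exact/continuous_subspaceT/trmx_continuous.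
  apply: (@rV_compact _ _ (fun i => `[a i 0, b i 0]%classic)) => i.
  exact: segment_compact.
apply/seteqP; split => [x abx|_ [v abv <-] i]; last first.
  by have /= := abv i; rewrite in_itv/= !mxE.
exists x^T; last by rewrite trmxK.
by move=> i /=; rewrite in_itv/= mxE; exact: abx.
Qed.

Lemma compact_sub_cbox A : compact A -> exists r : R,
  0 < r /\ A `<=` cbox (const_mx (- r)) (const_mx r).
Proof.
move=> /compact_bounded[M [_ AM]]; exists (`|M| + 1).
split; first by rewrite ltr_wpDl.
move=> x Ax i; rewrite !mxE -ler_norml.
apply: le_trans (le_coord_cV_norm x i) _; apply: AM => //.
by rewrite ltr_pwDr// ler_norm.
Qed.

(** The boxes below, with rational centre and radius, form a countable basis
    of the topology. *)
Definition qlo (q : 'cV[rat]_n * nat) : 'cV[R]_n :=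
  map_mx ratr q.1 - const_mx q.2.+1%:R^-1.
Definition qhi (q : 'cV[rat]_n * nat) : 'cV[R]_n :=
  map_mx ratr q.1 + const_mx q.2.+1%:R^-1.

Lemma open_bigcup_box A : open A ->
  A = \bigcup_(q in [set q | cbox (qlo q) (qhi q) `<=` A]) box (qlo q) (qhi q).
Proof.
move=> oA; apply/seteqP; split; last first.
  by move=> x [q /= qA /box_cbox]; exact: qA.
move=> x Ax; have /nbhs_ballP[e /= e0 xeA] : nbhs x A by exact: open_nbhs_nbhs.
have e20 : 0 < e / 2 by rewrite divr_gt0.
have [k ke] := ltr_add_invr e20; rewrite add0r in ke.
have k0 : 0 < k.+1%:R^-1 :> R by rewrite invr_gt0 ltr0n.
have /choice[c0 c0x] (i : 'I_n) : exists q : rat,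
    x i 0 - k.+1%:R^-1 < ratr q < x i 0 + k.+1%:R^-1.
  have /rat_in_itvoo[q] : x i 0 - k.+1%:R^-1 < x i 0 + k.+1%:R^-1.
    by rewrite ltrBlDr -addrA ltrDl addr_gt0.
  by rewrite in_itv/=; exists q.
exists (\col_i c0 i, k).
  move=> y /= yc; apply: xeA; rewrite mx_norm_ball /ball_ /=.
  apply: (@le_lt_trans _ _ (k.+1%:R^-1 + k.+1%:R^-1)); last first.
    by rewrite [ltRHS]splitr ltrD.
  apply: cV_norm_le => [|i]; first by rewrite ltW// addr_gt0.
  have := yc i; have := c0x i; rewrite !mxE /= ler_norml.
  move: (ratr _) (k.+1%:R^-1) => q r /andP[h1 h2] /andP[h3 h4].
  by apply/andP; split; lra.
move=> i; rewrite !mxE /=; have := c0x i.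
move: (ratr _) (k.+1%:R^-1) => q r /andP[h1 h2].
by apply/andP; split; lra.
Qed.

Lemma open_measurable_cV A : open A -> measurable A.
Proof.
move=> /open_bigcup_box ->; rewrite bigcup_mkcond.
apply: countable_bigcupT_measurable => // q; case: ifPn => // _.
exact: measurable_box.
Qed.

Lemma closed_measurable_cV A : closed A -> measurable A.
Proof.
by move=> cA; rewrite -(setCK A); apply: measurableC; apply: open_measurable_cV;
  rewrite openC.
Qed.

Lemma compact_closed_cV A : compact A -> closed A.
Proof. by apply: compact_closed; exact: norm_hausdorff. Qed.

Lemma compact_measurable_cV A : compact A -> measurable A.
Proof. by move=> cA; apply: closed_measurable_cV; exact: compact_closed_cV. Qed.

Lemma measurable_set1_cV x : measurable [set x].
Proof.
apply: closed_measurable_cV; apply: accessible_closed_set1.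
by apply: hausdorff_accessible; exact: norm_hausdorff.
Qed.

Lemma measurable_cbox a b : measurable (cbox a b).
Proof. by apply: closed_measurable_cV; exact: closed_cbox. Qed.

Lemma continuous_measurable_fun_cV (D : set 'cV[R]_n) (f : 'cV[R]_n -> R) :
  continuous f -> measurable_fun D f.
Proof.
move=> cf; apply: measurable_funTS => /=.
apply: (measurability _ (RGenOpens.measurableE R)).
move=> _ [_ [a [b ->] <-]]; rewrite setTI; apply: open_measurable_cV.
by apply: open_comp => [x _|]; [exact: cf|exact: interval_open].
Qed.

End boxes.
Arguments closed_cbox {R n} a b.
Arguments compact_cbox {R n} a b.

(** * Lebesgue measure: finiteness on boxes and iterated integration *)

Lemma continuous_cV {R : realType} n (T : topologicalType) (f : T -> 'cV[R]_n) :
  (forall i, continuous (fun x => f x i 0)) -> continuous f.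
Proof.
move=> cf x A /= -[P Px PA]; rewrite /nbhs/=.
have : nbhs x (fun y => forall i, P i 0 (f y i 0)).
  apply: (@filter_forall T 'I_n (fun i => [set y | P i 0 (f y i 0)])) => i.
  exact/(cf i x)/(Px i 0).
by apply: filterS => y Py; apply: PA => i j; rewrite ord1; exact: Py.
Qed.

Section cons_cV_entries.
Context {R : realType} {n : nat}.
Implicit Types (p : 'cV[R]_n * R) (x v : 'cV[R]_n) (t : R).

Lemma cons_cV0 p : cons_cV p 0 0 = p.2.
Proof.
have -> : (0 : 'I_n.+1) = lshift n (0 : 'I_1) by exact: val_inj.
by rewrite /cons_cV; apply: etrans (col_mxEu _ _ _ _) _; rewrite mxE eqxx mulr1n.
Qed.

Lemma cons_cV_lift p i : cons_cV p (lift ord0 i) 0 = p.1 i 0.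
Proof.
have -> : lift ord0 i = rshift 1 i by exact: val_inj.
exact: col_mxEd.
Qed.

Lemma cons_cVP p (x : 'cV[R]_n.+1) : x 0 0 = p.2 ->
  (forall i, x (lift ord0 i) 0 = p.1 i 0) -> cons_cV p = x.
Proof.
move=> x0 xS; apply/colP => i; case: (unliftP ord0 i) => [k|] ->.
  by rewrite cons_cV_lift xS.
by rewrite cons_cV0 x0.
Qed.

Lemma cons_cV_shift0 x (h t : R) :
  cons_cV (x, h *: 1 + t) = h *: delta_mx 0 0 + cons_cV (x, t).
Proof.
apply: cons_cVP => [|i]; rewrite mxE.
  by rewrite cons_cV0 !mxE.
by rewrite cons_cV_lift !mxE /= mulr0 add0r.
Qed.

Lemma cons_cV_shiftS x k (h t : R) :
  cons_cV (h *: delta_mx k 0 + x, t) =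
  h *: delta_mx (lift ord0 k) 0 + cons_cV (x, t).
Proof.
apply: cons_cVP => [|i]; rewrite mxE.
  by rewrite cons_cV0 !mxE /= mulr0 add0r.
by rewrite cons_cV_lift !mxE (inj_eq (@lift_inj _ _)).
Qed.

Lemma cons_cV_continuousl t : continuous (fun x => cons_cV (x, t)).
Proof.
apply: continuous_cV => i; case: (unliftP ord0 i) => [k|] ->.
  have -> : (fun x => cons_cV (x, t) (lift ord0 k) 0) = fun x => x k 0.
    by apply/funext => x; exact: cons_cV_lift.
  exact: coord_cV_continuous.
have -> : (fun x => cons_cV (x, t) ord0 0) = cst t.
  by apply/funext => x; exact: cons_cV0.
exact: cst_continuous.
Qed.

Lemma cons_cV_continuousr x : continuous (fun t => cons_cV (x, t)).
Proof.
apply: continuous_cV => i; case: (unliftP ord0 i) => [k|] ->.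
  have -> : (fun t => cons_cV (x, t) (lift ord0 k) 0) = cst (x k 0).
    by apply/funext => t; exact: cons_cV_lift.
  exact: cst_continuous.
have -> : (fun t => cons_cV (x, t) ord0 0) = id.
  by apply/funext => t; exact: cons_cV0.
by move=> t; exact: cvg_id.
Qed.

End cons_cV_entries.

Section lebesgue_cV_sigma_finite.
Context {R : realType}.
Local Open Scope ereal_scope.

Lemma lebesgue_cV_setX n (A : set 'cV[R]_n.+1) (B : set 'cV[R]_n) (I : set R) :
  measurable B -> measurable I -> (@cons_cV R n) @^-1` A = B `*` I ->
  lebesgue_cV n.+1 A = lebesgue_cV n B * lebesgue_measure I.
Proof.
by move=> mB mI AE; rewrite /= /lebesgue_cVS /pushforward AE product_measure1E.
Qed.

Lemma lebesgue_cV_cbox_lty n (r : R) :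
  lebesgue_cV n (cbox (const_mx (- r)%R) (const_mx r)) < +oo.
Proof.
elim: n => [|n ih].
  by rewrite /= /dirac indicE ltry.
rewrite (@lebesgue_cV_setX n _ (cbox (const_mx (- r)%R) (const_mx r)) `[(- r)%R, r]) //.
- apply: lte_mul_pinfty => //; last first.
    by rewrite lebesgue_measure_itv/=; case: ifPn => // _; rewrite -EFinB ltry.
  by rewrite ge0_fin_numE.
- exact: measurable_cbox.
- apply/seteqP; split => -[x t] /= => [xt|[xr]].
    split; last by have := xt ord0; rewrite cons_cV0 !mxE in_itv.
    by move=> i; have := xt (lift ord0 i); rewrite cons_cV_lift !mxE.
  rewrite in_itv/= => tr i; case: (unliftP ord0 i) => [k|] ->.
    by rewrite cons_cV_lift; have := xr k; rewrite !mxE.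
  by rewrite cons_cV0 !mxE.
Qed.

Lemma lebesgue_cV_bounded_lty n (A : set 'cV[R]_n) (r : R) : measurable A ->
  A `<=` cbox (const_mx (- r)%R) (const_mx r) -> lebesgue_cV n A < +oo.
Proof.
move=> mA Ar; apply: le_lt_trans (lebesgue_cV_cbox_lty n r).
by apply: le_measure => //; rewrite inE//; exact: measurable_cbox.
Qed.

Lemma lebesgue_cV_sigma_finite n : sigma_finite setT (@lebesgue_cV R n).
Proof.
exists (fun k => cbox (const_mx (- k%:R)%R) (const_mx k%:R)); last first.
  by move=> k; split; [exact: measurable_cbox|exact: lebesgue_cV_cbox_lty].
apply/seteqP; split => // x _; exists (Num.truncn `|x|).+1 => // i.
rewrite !mxE -ler_norml; apply: le_trans (le_coord_cV_norm x i) _.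
by apply/ltW; rewrite truncnS_gt.
Qed.

(** The origin lies in a coordinate hyperplane, which is null because one of its
    factors is a point. *)
Lemma lebesgue_cV_set1_0 n : (0 < n)%N -> lebesgue_cV n [set 0%R : 'cV[R]_n] = 0.
Proof.
case: n => // n _; pose H := [set x : 'cV[R]_n.+1 | x ord0 ord0 = 0%R].
have mH : measurable H.
  have := @measurable_mxentry _ R n.+1 1 ord0 ord0 measurableT [set 0%R].
  by rewrite setTI; apply; exact: measurable_set1.
have H0 : lebesgue_cV n.+1 H = 0.
  rewrite (@lebesgue_cV_setX n _ setT [set 0%R])//.
    by rewrite lebesgue_measure_set1 mule0.
  apply/seteqP; split => -[x t]; rewrite /H /=; have := cons_cV0 (x, t) => /= ->.
    by [].
  by case.
apply/eqP; rewrite -measure_le0 -H0; apply: le_measure; rewrite ?inE//.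
- exact: measurable_set1_cV.
- by move=> x ->; rewrite /H /= mxE.
Qed.

End lebesgue_cV_sigma_finite.

(** The recursive definition of the measure offers no head constant to which
    sigma-finiteness, and hence Fubini, could be attached; this alias does. *)
Definition sfin_lebesgue_cV {R : realType} n : set 'cV[R]_n -> \bar R :=
  lebesgue_cV n.
HB.instance Definition _ {R : realType} n := Measure.on (@sfin_lebesgue_cV R n).
HB.instance Definition _ {R : realType} n :=
  Measure_isSigmaFinite.Build _ _ _ (@sfin_lebesgue_cV R n)
    (@lebesgue_cV_sigma_finite R n).

Section fubini_cV.
Context {R : realType} {n : nat}.
Local Open Scope ereal_scope.
Variable f : 'cV[R]_n.+1 -> R.
Hypothesis f_int : (lebesgue_cV n.+1).-integrable setT (EFin \o f).

Local Notation m := (@sfin_lebesgue_cV R n).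

Let mf : measurable_fun [set: 'cV[R]_n.+1] (fun x => (f x)%:E).
Proof. by case/integrableP : f_int. Qed.

Let mcons : measurable_fun [set: 'cV[R]_n * measurableTypeR R] (@cons_cV R n).
Proof. exact: measurable_cons_cV. Qed.

Let prod_m : {measure set ('cV[R]_n * measurableTypeR R) -> \bar R} :=
  m \x (@lebesgue_measure R).

Let f_int' : prod_m.-integrable setT (fun p => (f (cons_cV p))%:E).
Proof.
apply/integrableP; split; first exact: measurableT_comp mf mcons.
have /integrableP[_] := f_int; apply: le_lt_trans.
rewrite [leRHS](_ : _ = \int[pushforward prod_m (@cons_cV R n)]_x `|(f x)%:E|) //.
rewrite (ge0_integral_pushforward mcons)//.
exact: measurableT_comp.
Qed.

Let intE : \int[lebesgue_cV n.+1]_x (f x)%:E = \int[prod_m]_p (f (cons_cV p))%:E.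
Proof.
rewrite [LHS](_ : _ = \int[pushforward prod_m (@cons_cV R n)]_x (f x)%:E) //.
by rewrite (integral_pushforward mcons).
Qed.

Lemma lebesgue_cV_fubini1 : \int[lebesgue_cV n.+1]_x (f x)%:E =
  \int[lebesgue_cV n]_x \int[lebesgue_measure]_t (f (cons_cV (x, t)))%:E.
Proof. by rewrite intE -(integral12_prod_meas1 f_int'). Qed.

Lemma lebesgue_cV_fubini2 : \int[lebesgue_cV n.+1]_x (f x)%:E =
  \int[lebesgue_measure]_t \int[lebesgue_cV n]_x (f (cons_cV (x, t)))%:E.
Proof. by rewrite intE -(integral21_prod_meas1 f_int'). Qed.

End fubini_cV.

(** * Integrating a partial derivative *)

Section integrable_cV.
Context {R : realType} {n : nat}.
Local Notation mu := (@lebesgue_cV R n).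
Implicit Types (f g : 'cV[R]_n -> R) (K : set 'cV[R]_n).

Lemma continuous_compact_bounded f K : continuous f -> compact K ->
  exists2 M, 0 < M & forall x, K x -> `|f x| <= M.
Proof.
move=> cf cK; have : compact (f @` K).
  by apply: continuous_compact => //; exact/continuous_subspaceT.
move=> /compact_bounded[M [_ fM]]; exists (`|M| + 1); first by rewrite ltr_wpDl.
by move=> x Kx; apply: fM; [rewrite ltr_pwDr// ler_norm|exists x].
Qed.

Lemma continuous_integrable_bounded f (D : set 'cV[R]_n) (r : R) : continuous f ->
  measurable D -> D `<=` cbox (const_mx (- r)) (const_mx r) ->
  mu.-integrable D (EFin \o f).
Proof.
move=> cf mD Dr; apply: measurable_bounded_integrable => //.
- exact: lebesgue_cV_bounded_lty Dr.
- exact: continuous_measurable_fun_cV.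
have [M M0 fM] := continuous_compact_bounded cf
  (compact_cbox (const_mx (- r)) (const_mx r)).
exists M; split; first exact: num_real.
by move=> N MN x Dx; apply: le_trans (ltW MN); apply/fM/Dr.
Qed.

Lemma continuous_integrable_supp f K : continuous f -> compact K ->
  (forall x, ~ K x -> f x = 0) -> mu.-integrable setT (EFin \o f).
Proof.
move=> cf cK f0; have mK := compact_measurable_cV cK.
have [r [_ Kr]] := compact_sub_cbox cK.
rewrite (_ : EFin \o f = (EFin \o f) \_ K).
  by apply/(integrable_mkcond _ mK)/(continuous_integrable_bounded cf mK Kr).
by apply/funext => x; rewrite patchE; case: ifPn => // /negP; rewrite inE => /f0/= ->.
Qed.

End integrable_cV.

(** Directional derivatives only see the function along a line, so they are
    unaffected by a change of variables that maps lines to lines. *)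
Lemma derive_comp_line {R : realType} (V W X : normedModType R) (f : V -> X)
    (phi : W -> V) (v : V) (w y : W) :
  (forall h : R, phi (h *: w + y) = h *: v + phi y) ->
  derivable (f \o phi) y w = derivable f (phi y) v /\
  'D_w (f \o phi) y = 'D_v f (phi y).
Proof.
move=> phiE; rewrite /derivable /derive.
suff -> : (fun h : R => h^-1 *: ((f \o phi \o shift y) (h *: w) - (f \o phi) y)) =
  (fun h : R => h^-1 *: ((f \o shift (phi y)) (h *: v) - f (phi y))) by [].
by apply/funext => h /=; rewrite phiE.
Qed.

Lemma integral_derive_supp {R : realType} (f : R -> R) (r : R) :
  (forall t, derivable f t 1) -> continuous (fun t => 'D_1 f t) ->
  (forall t, r < `|t| -> f t = 0) -> (\int[lebesgue_measure]_t ('D_1 f t)%:E = 0)%E.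
Proof.
move=> df cf f0; pose a : R := `|r| + 1.
have ra : r < a by rewrite (le_lt_trans (ler_norm _))// ltrDl.
have a0 : 0 < a by rewrite ltr_wpDl.
have cf' : continuous f by move=> t; exact/differentiable_continuous/derivable1_diffP.
have df0 (t : R) : ~ `[- a, a]%classic t -> 'D_1 f t = 0.
  rewrite /= in_itv/= => /negP; rewrite -ler_norml -ltNge => at_.
  rewrite (@near_eq_derive _ _ _ f (cst 0)) ?derive_cst//.
  have : \forall s \near t, r < `|s|.
    have : (fun s : R => `|s|) s @[s --> t] --> `|t| by exact: norm_continuous.
    by move/cvgr_gt; apply; exact: lt_trans at_.
  by apply: filterS => s /f0.
(* Both f and its derivative vanish outside [-a, a], endpoints included. *)
have -> : (\int[lebesgue_measure]_t ('D_1 f t)%:E =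
           \int[lebesgue_measure]_(t in `[(- a)%R, a]) ('D_1 f t)%:E)%E.
  rewrite [RHS]integral_mkcond; apply: eq_integral => t _; rewrite patchE.
  by case: ifPn => // /negP; rewrite inE => /df0 ->.
rewrite (@continuous_FTC2 _ _ f) ?f0 ?subee//.
- by rewrite normrN (gtr0_norm a0).
- by rewrite (gtr0_norm a0).
- by rewrite gtrN.
- exact: continuous_subspaceT.
- split => //.
  + exact/cvg_at_right_filter/cf'.
  + exact/cvg_at_left_filter/cf'.
- by move=> t _; rewrite derive1E.
Qed.

Section integral_partial.
Context {R : realType}.

Lemma partial_out n (j : 'I_n) (f : 'cV[R]_n -> R) (K : set 'cV[R]_n) : closed K ->
  (forall x, ~ K x -> f x = 0) -> forall x, ~ K x -> partial j f x = 0.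
Proof.
move=> cK f0 x Kx; rewrite /partial (@near_eq_derive _ _ _ f (cst 0)) ?derive_cst//.
have : open_nbhs x (~` K) by split => //; rewrite openC.
by move/open_nbhs_nbhs; apply: filterS => y /f0.
Qed.

(** By induction on the dimension, splitting off the first coordinate with
    Fubini: if the derivative is along that coordinate, the inner integral is
    one-dimensional and vanishes by the fundamental theorem of calculus;
    otherwise the inner integral is over the remaining coordinates. *)
Lemma integral_partial_cbox n (j : 'I_n) (f : 'cV[R]_n -> R) (r : R) :
  (forall x, derivable f x (delta_mx j 0)) -> continuous (partial j f) ->
  (forall x, ~ cbox (const_mx (- r)) (const_mx r) x -> f x = 0) ->
  (\int[lebesgue_cV n]_x (partial j f x)%:E = 0)%E.
Proof.
elim: n j f => [[]//|n ih] j f df cf f0.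
have int_f : (lebesgue_cV n.+1).-integrable setT (EFin \o partial j f).
  apply: continuous_integrable_supp cf (compact_cbox _ _) _.
  exact: partial_out (closed_cbox _ _) f0.
case: (unliftP ord0 j) => [k|] jE; subst j.
  rewrite (lebesgue_cV_fubini2 int_f) integral0_eq// => t _.
  have E x := @derive_comp_line _ _ _ _ f (fun x => cons_cV (x, t))
    (delta_mx (lift ord0 k) 0) (delta_mx k 0) x (fun h => cons_cV_shiftS x k h t).
  have pE : (fun x => partial (lift ord0 k) f (cons_cV (x, t))) =
            partial k (f \o (fun x => cons_cV (x, t))).
    by apply/funext => x; rewrite /partial (E x).2.
  rewrite -[RHS](@ih k (f \o (fun x => cons_cV (x, t)))) -?pE//.
  - by move=> x; rewrite (E x).1.
  - by move=> x; apply: continuous_comp; [exact: cons_cV_continuousl|exact: cf].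
  - move=> x xr; apply: f0; apply: contra_not xr => xr i.
    by have := xr (lift ord0 i); rewrite cons_cV_lift !mxE.
rewrite (lebesgue_cV_fubini1 int_f) integral0_eq// => x _.
have E t := @derive_comp_line _ _ _ _ f (fun t => cons_cV (x, t))
  (delta_mx ord0 0) 1 t (fun h => cons_cV_shift0 x h t).
have pE t : partial ord0 f (cons_cV (x, t)) = 'D_1 (f \o (fun t => cons_cV (x, t))) t.
  by rewrite /partial (E t).2.
rewrite -[RHS](@integral_derive_supp _ (f \o (fun t => cons_cV (x, t))) r).
- by apply: eq_integral => t _; rewrite pE.
- by move=> t; rewrite (E t).1.
- rewrite (_ : (fun t => _) = partial ord0 f \o (fun t => cons_cV (x, t))).
    by move=> t; apply: continuous_comp; [exact: cons_cV_continuousr|exact: cf].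
  by apply/funext => t /=; rewrite pE.
- move=> t rt; apply: f0 => /(_ ord0); rewrite cons_cV0 !mxE -ler_norml.
  by rewrite leNgt rt.
Qed.

Lemma integral_partial_supp n (j : 'I_n) (f : 'cV[R]_n -> R) (K D : set 'cV[R]_n) :
  (forall x, derivable f x (delta_mx j 0)) -> continuous (partial j f) ->
  compact K -> K `<=` D -> (forall x, ~ K x -> f x = 0) ->
  (\int[lebesgue_cV n]_(x in D) (partial j f x)%:E = 0)%E.
Proof.
move=> df cf cK KD f0; have [r [_ Kr]] := compact_sub_cbox cK.
rewrite -[RHS](integral_partial_cbox df cf (r := r)).
  rewrite integral_mkcond; apply: eq_integral => x _; rewrite patchE.
  case: ifPn => // /negP; rewrite inE => Dx.
  rewrite (@partial_out _ j f K) //; last by move/KD.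
  exact: compact_closed_cV.
by move=> x xr; apply: f0; apply: contra_not xr; exact: Kr.
Qed.

End integral_partial.

(** * Smooth bumps filling a box *)

Section flat.
Context {R : realType}.
Implicit Types (y : R) (k : nat).

(** The family [y ^- k * exp (- 1 / y)] is stable under differentiation, up to
    linear combinations; this is what makes [flat 0] smooth. *)
Definition flat k y : R := if 0 < y then y^-1 ^+ k * expR (- y^-1) else 0.

Lemma flat_gt0 k y : 0 < y -> flat k y = y^-1 ^+ k * expR (- y^-1).
Proof. by rewrite /flat => ->. Qed.

Lemma flat_le0 k y : y <= 0 -> flat k y = 0.
Proof. by rewrite /flat leNgt => /negbTE ->. Qed.

Lemma flat_ge0 k y : 0 <= flat k y.
Proof.
rewrite /flat; case: ifPn => // y0.
by rewrite mulr_ge0 ?expR_ge0// exprn_ge0// invr_ge0 ltW.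
Qed.

Lemma flat0_le1 y : flat 0 y <= 1.
Proof.
rewrite /flat; case: ifPn => // y0; rewrite expr0 mul1r expR_le1 oppr_le0.
by rewrite invr_ge0 ltW.
Qed.

(** The exponential series beats every power of [1 / y]. *)
Lemma flat_le k y : `|flat k y| <= k.+1`!%:R * `|y|.
Proof.
rewrite ger0_norm ?flat_ge0//; have [y0|y0] := leP y 0.
  by rewrite flat_le0// mulr_ge0.
rewrite flat_gt0// gtr0_norm// expRN ler_pdivrMr ?expR_gt0//.
have yV0 : 0 <= y^-1 by rewrite invr_ge0 ltW.
have h : y^-1 ^+ k.+1 <= k.+1`!%:R * expR y^-1.
  rewrite mulrC -ler_pdivrMr ?ltr0n ?fact_gt0//.
  by apply: le_trans (expR_ge1Dxn k yV0); rewrite lerDr.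
rewrite -mulrA [y * _]mulrC mulrA -ler_pdivrMr// mulrC -exprS.
exact: h.
Qed.

Lemma flat_cvg0 k : flat k y @[y --> (0 : R)] --> (0 : R).
Proof.
apply: (@norm_cvg0 _ R^o); apply: (squeeze_cvgr (f := fun=> 0)
  (h := fun y => k.+1`!%:R * `|y|)).
- by near=> y; rewrite normr_ge0 flat_le.
- exact: cvg_cst.
- have h : `|y| @[y --> (0 : R)] --> (0 : R).
    by rewrite -[X in _ --> X](@normr0 _ R); apply: cvg_norm; exact: cvg_id.
  by rewrite -[X in _ --> X](mulr0 k.+1`!%:R); apply: cvgM h; exact: cvg_cst.
Unshelve. all: by end_near. Qed.

Lemma is_derive_flat k y :
  is_derive y 1 (flat k) (- k%:R * flat k.+1 y + flat k.+2 y).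
Proof.
have [y0|y0|->] := ltgtP y 0.
- rewrite !flat_le0 ?ltW// mulr0 addr0.
  apply: (@near_eq_is_derive _ _ _ (cst (0 : R))).
  by near=> z; rewrite flat_le0//; apply/ltW; near: z; exact: lt_nbhsl.
- have iV : is_derive y 1 (fun z : R => z^-1) (- y ^- 2).
    apply: DeriveDef; first by apply: (@derivableV _ _ id) => //; rewrite gt_eqF.
    by rewrite (@deriveV _ _ id) ?gt_eqF// derive_id /GRing.scale/= mulr1.
  have iX : is_derive y 1 (fun z : R => z^-1 ^+ k) (- k%:R * y^-1 ^+ k.+1).
    have -> : (fun z : R => z^-1 ^+ k) = (fun z : R => z^-1) ^+ k.
      by rewrite exprfctE.
    apply: is_derive_eq; rewrite /GRing.scale/=.
    case: k => [|k]; first by rewrite !mul0r oppr0 mul0r.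
    by rewrite -[y ^- 2]exprVn /= !exprSr; move: (y^-1) => z; ring.
  have iE : is_derive y 1 (fun z : R => expR (- z^-1)) (expR (- y^-1) * y ^- 2).
    apply: is_derive_eq (is_derive1_comp (is_derive_expR _) (is_deriveN iV)) _.
    by rewrite opprK /GRing.scale/=.
  apply: near_eq_is_derive (is_derive_eq (is_deriveM iX iE) _).
    by near=> z; rewrite flat_gt0//; near: z; exact: lt_nbhsr.
  rewrite !flat_gt0// /GRing.scale/= -exprVn !exprS.
  by move: (y^-1) (expR _) => z E; ring.
- rewrite !flat_le0// mulr0 addr0.
  (* At 0 the difference quotient of flat k is flat k.+1. *)
  have h0 : (fun h : R => h^-1 *: (flat k (h *: (1 : R) + 0) - flat k 0)) @ 0^' --> (0 : R).
    have : flat k.+1 h @[h --> (0 : R)^'] --> (0 : R).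
      by apply: cvg_within_filter; exact: flat_cvg0.
    apply: cvg_trans; apply: near_eq_cvg.
    near=> h; rewrite (flat_le0 _ (lexx 0)) subr0 addr0 /GRing.scale/= mulr1 /flat.
    by case: ifPn => // _; rewrite ?mulr0// exprS mulrA.
  apply: DeriveDef; first by apply/cvg_ex; exists 0.
  exact: cvg_lim h0.
Unshelve. all: by end_near. Qed.

Lemma continuous_flat k : continuous (flat k).
Proof.
move=> y; apply/differentiable_continuous/derivable1_diffP.
by have [] := is_derive_flat k y.
Qed.

(** Stretching the profile makes it converge to the indicator of the positive
    half-line. *)
Lemma flat_cvg1 y : 0 < y -> flat 0 (n.+1%:R * y) @[n --> \oo] --> (1 : R).
Proof.
move=> y0; have -> : (fun n => flat 0 (n.+1%:R * y)) =
    (fun n => expR (- (harmonic n * y^-1))).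
  by apply/funext => n; rewrite flat_gt0 ?mulr_gt0// expr0 mul1r invfM.
have h0 : - (harmonic n * y^-1) @[n --> \oo] --> (0 : R).
  rewrite -oppr0; apply: cvgN; rewrite -(mul0r y^-1).
  by apply: cvgM; [exact: cvg_harmonic|exact: cvg_cst].
by rewrite -[X in _ --> X](@expR0 R); exact: (cvg_comp _ _ h0 (@continuous_expR R 0)).
Qed.

End flat.

Section smoothness.
Context {R : realType} {n : nat}.
Implicit Types (f g : 'cV[R]_n -> R) (j : 'I_n).

(** [k] times continuously differentiable in the sense of partial derivatives.
    Unlike [smooth] this peels derivatives off the inside, which suits
    inductions on [k]. *)
Fixpoint Ck (k : nat) f : Prop :=
  match k with
  | 0 => continuous f
  | k'.+1 => [/\ continuous f, forall j x, derivable f x (delta_mx j 0) &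
               forall j, Ck k' (partial j f)]
  end.

Lemma CkS k f : Ck k.+1 f -> Ck k f.
Proof.
by elim: k f => [|k ih] f [cf df pf]//; split=> // j; exact/ih/pf.
Qed.

Lemma Ck_smooth f : (forall k, Ck k f) -> smooth f.
Proof.
move=> Cf s; elim/last_ind: s f Cf => [|s j ih] f Cf.
  by split; [exact: (Cf 0%N)|have [] := Cf 1%N].
by rewrite foldr_rcons; apply: ih => k; have [_ _] := Cf k.+1; exact.
Qed.

Lemma smooth_partial j f : smooth f -> smooth (partial j f).
Proof. by move=> sf s; have := sf (rcons s j); rewrite foldr_rcons. Qed.

Lemma smooth_continuous f : smooth f -> continuous f.
Proof. by move=> /(_ [::])[]. Qed.

Lemma smooth_derivable f x j : smooth f -> derivable f x (delta_mx j 0).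
Proof. by move=> /(_ [::])[_]; exact. Qed.

Lemma smooth_partial_continuous f j : smooth f -> continuous (partial j f).
Proof. by move=> /smooth_partial-/(_ j)/smooth_continuous. Qed.

Lemma partialD f g j : (forall x, derivable f x (delta_mx j 0)) ->
  (forall x, derivable g x (delta_mx j 0)) ->
  partial j (fun x => f x + g x) = (fun x => partial j f x + partial j g x).
Proof. by move=> df dg; apply/funext => x; exact: deriveD. Qed.

Lemma partialM f g j : (forall x, derivable f x (delta_mx j 0)) ->
  (forall x, derivable g x (delta_mx j 0)) ->
  partial j (fun x => f x * g x) =
  (fun x => f x * partial j g x + g x * partial j f x).
Proof. by move=> df dg; apply/funext => x; exact: deriveM. Qed.

Lemma Ck_cst k (c : R) : Ck k (fun=> c).
Proof.
elim: k c => [|k ih] c; first exact: cst_continuous.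
split=> [|j x|j]; [exact: cst_continuous|exact: derivable_cst|].
rewrite (_ : partial j _ = fun=> 0); first exact: ih.
by apply/funext => x; exact: derive_cst.
Qed.

Lemma CkD k f g : Ck k f -> Ck k g -> Ck k (fun x => f x + g x).
Proof.
elim: k f g => [|k ih] f g.
  by move=> cf cg x; apply: continuousD; [exact: cf|exact: cg].
move=> [cf df pf] [cg dg pg]; split.
- by move=> x; apply: continuousD; [exact: cf|exact: cg].
- by move=> j x; apply: derivableD; [exact: df|exact: dg].
- by move=> j; rewrite partialD//; apply: ih; [exact: pf|exact: pg].
Qed.

Lemma CkM k f g : Ck k f -> Ck k g -> Ck k (fun x => f x * g x).
Proof.
elim: k f g => [|k ih] f g.
  by move=> cf cg x; apply: continuousM; [exact: cf|exact: cg].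
move=> Cf Cg; have [cf df pf] := Cf; have [cg dg pg] := Cg; split.
- by move=> x; apply: continuousM; [exact: cf|exact: cg].
- by move=> j x; apply: derivableM; [exact: df|exact: dg].
- move=> j; rewrite partialM//.
  apply: CkD; apply: ih; [exact: CkS Cf|exact: pg|exact: CkS Cg|exact: pf].
Qed.

Lemma Ck_prod k (I : Type) (s : seq I) (F : I -> 'cV[R]_n -> R) :
  (forall i, Ck k (F i)) -> Ck k (fun x => \prod_(i <- s) F i x).
Proof.
move=> CF; elim: s => [|i s ih].
  rewrite (_ : (fun x => _) = fun=> 1); first exact: Ck_cst.
  by apply/funext => x; rewrite big_nil.
rewrite (_ : (fun x => _) = fun x => F i x * \prod_(j <- s) F j x).
  exact: CkM.
by apply/funext => x; rewrite big_cons.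
Qed.

Lemma derive_flat_affine k (al be : R) (i j : 'I_n) (x : 'cV[R]_n) :
  derivable (fun x : 'cV[R]_n => flat k (al * x i 0 + be)) x (delta_mx j 0) /\
  partial j (fun x : 'cV[R]_n => flat k (al * x i 0 + be)) x =
  al * (i == j)%:R * (- k%:R * flat k.+1 (al * x i 0 + be) +
                      flat k.+2 (al * x i 0 + be)).
Proof.
have [] := @derive_comp_line R R^o _ R^o (flat k) (fun x : 'cV[R]_n => al * x i 0 + be)
  (al * (i == j)%:R) (delta_mx j 0) x.
  by move=> h; rewrite /GRing.scale/= !mxE eqxx andbT; ring.
rewrite /partial /comp => -> ->.
have [dF DF] := is_derive_flat k (al * x i 0 + be).
have dF' : differentiable (flat k : R^o -> R^o) (al * x i 0 + be).
  exact/derivable1_diffP.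
split; first exact: diff_derivable.
by rewrite deriveE// diff1E// derive1E DF.
Qed.

Lemma Ck_flat_affine m k (al be : R) (i : 'I_n) :
  Ck m (fun x : 'cV[R]_n => flat k (al * x i 0 + be)).
Proof.
have cf l : continuous (fun x : 'cV[R]_n => flat l (al * x i 0 + be)).
  move=> x; apply: (@continuous_comp _ _ _ (fun x : 'cV[R]_n => al * x i 0 + be)
    (flat l)); last exact: continuous_flat.
  apply: continuousD; last exact: cst_continuous.
  by apply: continuousM; [exact: cst_continuous|exact: coord_cV_continuous].
elim: m k => [|m ih] k; first exact: cf.
split => [|j x|j]; [exact: cf|by have [] := derive_flat_affine k al be i j x|].
rewrite (_ : partial j _ = fun x => al * (i == j)%:R *
   (- k%:R * flat k.+1 (al * x i 0 + be) + flat k.+2 (al * x i 0 + be))).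
  by do ![apply: CkM|apply: CkD|exact: ih|exact: Ck_cst].
by apply/funext => x; have [] := derive_flat_affine k al be i j x.
Qed.

(** A smooth function supported in the box that increases, as [m] grows, to its
    indicator: testing against it amounts to integrating over the box. *)
Definition box_bump (a b : 'cV[R]_n) (m : nat) (x : 'cV[R]_n) : R :=
  \prod_(i < n) (flat 0 (m.+1%:R * (x i 0 - a i 0)) *
                 flat 0 (m.+1%:R * (b i 0 - x i 0))).

Lemma smooth_box_bump a b m : smooth (box_bump a b m).
Proof.
apply: Ck_smooth => k; apply: Ck_prod => i; apply: CkM.
- rewrite (_ : (fun x => _) = fun x : 'cV[R]_n =>
      flat 0 (m.+1%:R * x i 0 + - (m.+1%:R * a i 0))); first exact: Ck_flat_affine.
  by apply/funext => x; rewrite mulrBr.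
- rewrite (_ : (fun x => _) = fun x : 'cV[R]_n =>
      flat 0 (- m.+1%:R * x i 0 + m.+1%:R * b i 0)); first exact: Ck_flat_affine.
  by apply/funext => x; rewrite mulrBr addrC mulNr.
Qed.

Lemma box_bump_out a b m x : ~ box a b x -> box_bump a b m x = 0.
Proof.
move=> /existsNP[i /negP]; rewrite negb_and -!leNgt => abx.
rewrite /box_bump (bigD1 i)//=; case/orP: abx => h.
  by rewrite (@flat_le0 _ _ (_ * (x i 0 - _))) ?mul0r// mulr_ge0_le0// subr_le0.
by rewrite (@flat_le0 _ _ (_ * (b i 0 - _))) ?mulr0 ?mul0r// mulr_ge0_le0// subr_le0.
Qed.

Lemma box_bump_ge0 a b m x : 0 <= box_bump a b m x.
Proof. by apply: prodr_ge0 => i _; rewrite mulr_ge0// flat_ge0. Qed.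

Lemma box_bump_le1 a b m x : box_bump a b m x <= 1.
Proof.
rewrite -[leRHS](@big1_eq _ 1 *%R 'I_n
  (index_enum 'I_n) predT).
apply: ler_prod => i _; rewrite mulr_ge0 ?flat_ge0//=.
by rewrite mulr_ile1 ?flat_ge0 ?flat0_le1.
Qed.

Lemma box_bump_cvg a b x : box_bump a b m x @[m --> \oo] --> (\1_(box a b) x : R).
Proof.
have [abx|abx] := pselect (box a b x); last first.
  rewrite indicE memNset//; under eq_cvg do rewrite box_bump_out//; exact: cvg_cst.
rewrite indicE mem_set// mulr1n -[X in _ --> X](@big1_eq _ 1 *%R 'I_n
  (index_enum 'I_n) predT).
rewrite /box_bump.
have {}abx i : (0 < x i 0 - a i 0) /\ (0 < b i 0 - x i 0).
  by rewrite !subr_gt0; apply/andP; exact: abx.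
elim: (index_enum _) => [|i s ih].
  by under eq_cvg do rewrite big_nil; rewrite big_nil; exact: cvg_cst.
under eq_cvg do rewrite big_cons.
rewrite big_cons; apply: cvgM => //; rewrite -[X in _ --> X]mulr1.
by apply: cvgM; apply: flat_cvg1; have [] := abx i.
Qed.

Lemma test_function_box_bump a b m (D : set 'cV[R]_n) : cbox a b `<=` D ->
  test_function D (box_bump a b m).
Proof.
move=> abD; have supp : closure [set x | box_bump a b m x != 0] `<=` cbox a b.
  rewrite (closure_id (cbox a b)).1; last exact: closed_cbox.
  apply: closure_subset => x /= /eqP x0; apply: box_cbox.
  by apply: contrapT => /(box_bump_out m).
split; first exact: smooth_box_bump.
- apply: subclosed_compact supp; last exact: compact_cbox.
  exact: closed_closure.
- exact: subset_trans abD.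
Qed.

End smoothness.

(** * Uniqueness of weak derivatives *)

Section boxes_generate.
Context {R : realType} {n : nat}.

Definition boxes : set (set 'cV[R]_n) := [set E | exists a b, E = box a b].

Lemma setI_box (a b c d : 'cV[R]_n) : box a b `&` box c d =
  box (\col_i Num.max (a i 0) (c i 0)) (\col_i Num.min (b i 0) (d i 0)).
Proof.
apply/seteqP; split => [x [abx cdx] i|x h].
  by rewrite !mxE gt_max lt_min; case/andP: (abx i) => -> ->; exact: cdx.
split=> i; have := h i; rewrite !mxE gt_max lt_min.
  by move=> /andP[/andP[-> _] /andP[-> _]].
by move=> /andP[/andP[_ ->] /andP[_ ->]].
Qed.

Lemma setI_closed_boxes : setI_closed boxes.
Proof.
by move=> _ _ [a [b ->]] [c [d ->]]; rewrite setI_box; eexists; eexists.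
Qed.

(** A cylinder over an open interval is a countable union of boxes, and these
    cylinders generate the sigma-algebra of the entries. *)
Lemma measurable_boxes : @measurable _ 'cV[R]_n `<=` <<s boxes >>.
Proof.
apply: smallest_sub; first exact: smallest_sigma_algebra.
move=> _ /= [i [j [B mB ->]]]; rewrite ord1.
have : measurable_fun setT (fun x : g_sigma_algebraType boxes => (x : 'cV[R]_n) i 0).
  apply: (measurability _ (RGenOpens.measurableE R)).
  move=> _ [_ [s [t ->] <-]]; rewrite setTI.
  rewrite (_ : _ @^-1` _ = \bigcup_k
     box (\col_j (if j == i then s else - k%:R)) (\col_j (if j == i then t else k%:R))).
    apply: bigcupT_measurable => k; apply: sub_sigma_algebra.
    by eexists; eexists; reflexivity.
  apply/seteqP; split => x /=.
    rewrite in_itv/= => xst; exists (Num.truncn `|x|).+1 => // k; rewrite !mxE.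
    case: eqP => [->//|_]; rewrite -ltr_norml.
    by apply: le_lt_trans (le_coord_cV_norm x k) _; rewrite truncnS_gt.
  by move=> [k _ /(_ i)]; rewrite !mxE eqxx in_itv.
by move=> /(_ measurableT _ mB); rewrite setTI.
Qed.

End boxes_generate.

Section fundamental_lemma.
Context {R : realType} {n : nat}.
Local Notation mu := (@lebesgue_cV R n).
Implicit Types (D : set 'cV[R]_n) (g : 'cV[R]_n -> R) (a b : 'cV[R]_n).
Local Open Scope ereal_scope.

Lemma loc_integrable_compact D g K : measurable D -> loc_integrable D g ->
  compact K -> K `<=` D -> mu.-integrable K (EFin \o g).
Proof.
move=> mD [mg ig] cK KD; apply/integrableP; split; last exact: ig.
by apply/measurable_EFinP; apply: measurable_funS mg.
Qed.

(** Dominated convergence along the bumps that increase to the indicator of the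
    box. *)
Lemma integral_box_eq0 D g a b : measurable D -> loc_integrable D g ->
  (forall phi, test_function D phi -> \int[mu]_(x in D) (g x * phi x)%:E = 0) ->
  cbox a b `<=` D -> \int[mu]_(x in box a b) (g x)%:E = 0.
Proof.
move=> mD lg g0 abD.
have gi := loc_integrable_compact mD lg (compact_cbox a b) abD.
have gm : measurable_fun (cbox a b) g.
  by apply/measurable_EFinP; exact: measurable_int gi.
have mQ := measurable_cbox a b.
have phi_m m : measurable_fun (cbox a b) (box_bump a b m).
  apply: continuous_measurable_fun_cV; apply: smooth_continuous.
  exact: smooth_box_bump.
have E0 m : \int[mu]_(x in cbox a b) (g x * box_bump a b m x)%:E = 0.
  rewrite -[RHS](g0 _ (@test_function_box_bump _ _ a b m D abD)).
  rewrite [LHS]integral_mkcond [RHS]integral_mkcond; apply: eq_integral => x _.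
  rewrite !patchE; case: ifPn => xQ; first by rewrite mem_set//; exact/abD/set_mem.
  case: ifPn => // _; rewrite box_bump_out ?mulr0// => /box_cbox.
  by move: xQ; rewrite notin_setE.
have [|||||_ _] := @dominated_convergence _ _ _ mu (cbox a b) mQ
  (fun m x => (g x * box_bump a b m x)%:E) (fun x => (g x * \1_(box a b) x)%:E)
  (fun x => `|g x|%:E).
- by move=> m; apply/measurable_EFinP/measurable_funM.
- apply/measurable_EFinP/measurable_funM => //.
  by apply: measurable_indic; exact: measurable_box.
- apply: aeW => x _; apply: cvg_EFin; first exact: nearW.
  by apply: cvgM; [exact: cvg_cst|exact: box_bump_cvg].
- by have := integrable_abse gi.
- apply: aeW => x m _; rewrite lee_fin normrM ler_piMr//.
  by rewrite ger0_norm ?box_bump_ge0 ?box_bump_le1.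
rewrite (_ : [sequence _]_n = cst 0); last by apply/funext => m; exact: E0.
move=> /(cvg_unique (@ereal_hausdorff R) (cvg_cst _)) ->.
rewrite [LHS]integral_mkcond [RHS]integral_mkcond; apply: eq_integral => x _.
rewrite !patchE indicE; have [xb|xb] := boolP (x \in box a b).
  by rewrite mem_set ?mulr1//; exact/box_cbox/set_mem.
by rewrite mulr0; case: ifPn.
Qed.

(** The integral of [g] vanishes on all sub-boxes; these form a pi-system, so it
    vanishes on all measurable subsets. *)
Lemma ae_eq0_box D g a b : measurable D -> loc_integrable D g ->
  (forall phi, test_function D phi -> \int[mu]_(x in D) (g x * phi x)%:E = 0) ->
  cbox a b `<=` D -> ae_eq mu (box a b) (EFin \o g) (cst 0).
Proof.
move=> mD lg g0 abD; have mB := measurable_box a b.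
have gi : mu.-integrable (box a b) (EFin \o g).
  apply: (integrableS (measurable_cbox a b)) => //; first exact: box_cbox.
  exact: loc_integrable_compact mD lg (compact_cbox a b) abD.
have giS E : measurable E -> mu.-integrable (E `&` box a b) (EFin \o g).
  by move=> mE; apply: integrableS gi => //; exact: measurableI.
have box0 c d : \int[mu]_(x in box c d `&` box a b) (g x)%:E = 0.
  rewrite setI_box; apply: (integral_box_eq0 mD lg g0) => x xQ; apply: abD => i.
  by have := xQ i; rewrite !mxE ge_max le_min => /andP[/andP[_ ->] /andP[_ ->]].
have int0 E : measurable E -> \int[mu]_(x in E `&` box a b) (g x)%:E = 0.
  move=> mE; pose H := [set E | measurable E /\
    \int[mu]_(x in E `&` box a b) (g x)%:E = 0].
  suff : <<s boxes >> `<=` H by move/(_ E (measurable_boxes mE)) => -[].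
  apply: (lambda_system_subset setI_closed_boxes) => //; last first.
    by move=> _ [c [d ->]]; split; [exact: measurable_box|exact: box0].
  apply/dynkin_lambda_system; split.
  - by split=> //; rewrite setTI -(setIid (box a b)).
  - move=> A [mA A0]; split; first exact: measurableC.
    have : \int[mu]_(x in (A `&` box a b) `|` (~` A `&` box a b)) (g x)%:E = 0.
      by rewrite -setIUl setUCr setTI -(setIid (box a b)).
    rewrite integral_setU_EFin ?A0 ?add0e//.
    + exact: measurableI.
    + by apply: measurableI => //; exact: measurableC.
    + rewrite -setIUl setUCr setTI.
      by apply/measurable_EFinP; exact: measurable_int gi.
    + by apply/disj_setPS => x [[Ax _] [nAx _]].
  - move=> F tF FH; have mF k : measurable (F k) by case: (FH k).
    split; first exact: bigcupT_measurable.
    rewrite setI_bigcupl integral_bigcup//.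
    + by apply: eseries0 => k _ _; case: (FH k).
    + apply/trivIsetP => i j _ _ ij; rewrite setIACA.
      by move/trivIsetP : tF => /(_ i j Logic.I Logic.I ij) ->; rewrite set0I.
    + by move=> k; exact: measurableI.
    + rewrite -setI_bigcupl; apply: giS; exact: bigcupT_measurable.
apply: integral_ae_eq => // E EB mE; rewrite integral_cst// mul0e.
by rewrite -(setIidl EB) int0.
Qed.

(** An open set is the union of countably many boxes whose closure it contains,
    so the null sets of the preceding lemma add up to a null set. *)
Lemma fundamental_lemma D g : open D -> loc_integrable D g ->
  (forall phi, test_function D phi -> \int[mu]_(x in D) (g x * phi x)%:E = 0) ->
  ae_eq mu D g (cst 0%R).
Proof.
move=> oD lg g0; have mD := open_measurable_cV oD.
pose P q := cbox (qlo q) (qhi q) `<=` D.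
pose F q : set 'cV[R]_n := if `[< P q >] then
  box (qlo q) (qhi q) `&` [set x | g x != 0%R] else set0.
have F0 q : mu.-negligible (F q).
  rewrite /F; case: asboolP => Pq; last exact: negligible_set0.
  apply: negligibleS (ae_eq0_box mD lg g0 Pq) => x [xq /eqP gx0] /=.
  by move=> /(_ xq) [].
pose G k := if unpickle k is Some q then F q else set0.
apply: negligibleS (negligible_bigcup (F := G) _); last first.
  by move=> k; rewrite /G; case: unpickle => // ; exact: negligible_set0.
move=> x /= /not_implyP[]; rewrite {1}(open_bigcup_box oD) => -[q /= Pq xq] /eqP gx0.
exists (pickle q) => //; rewrite /G pickleK /F.
by case: asboolP.
Qed.

End fundamental_lemma.

(** * Calculus of weak derivatives *)

Section continuous_real.
Context {R : realType} {T : topologicalType}.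
Implicit Types f g : T -> R.

Lemma continuous_addr f g : continuous f -> continuous g ->
  continuous (fun x => f x + g x).
Proof. by move=> cf cg x; apply: continuousD; [exact: cf|exact: cg]. Qed.

Lemma continuous_mulr f g : continuous f -> continuous g ->
  continuous (fun x => f x * g x).
Proof. by move=> cf cg x; apply: continuousM; [exact: cf|exact: cg]. Qed.

End continuous_real.

Section weak_partial_theory.
Context {R : realType} {n : nat}.
Local Notation mu := (@lebesgue_cV R n).
Implicit Types (D K : set 'cV[R]_n) (f g phi : 'cV[R]_n -> R) (j : 'I_n).
Local Open Scope ereal_scope.

Lemma continuous_loc_integrable D f : continuous f -> loc_integrable D f.
Proof.
move=> cf; split; first exact: continuous_measurable_fun_cV.
move=> K cK KD; have [r [_ Kr]] := compact_sub_cbox cK.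
have := continuous_integrable_bounded cf (compact_measurable_cV cK) Kr.
by move/integrableP => [].
Qed.

Lemma integrable_loc_mul D K g phi : measurable D -> loc_integrable D g ->
  continuous phi -> compact K -> K `<=` D -> (forall x, ~ K x -> phi x = 0%R) ->
  mu.-integrable D (fun x => (g x * phi x)%:E).
Proof.
move=> mD lg cphi cK KD phi0; have mK := compact_measurable_cV cK.
have gi := loc_integrable_compact mD lg cK KD.
have [M M0 phiM] := continuous_compact_bounded cphi cK.
suff gphi : mu.-integrable K (fun x => (g x * phi x)%:E).
  apply/(integrable_mkcond _ mD); move/(integrable_mkcond _ mK) : gphi.
  congr (mu.-integrable setT _); apply/funext => x; rewrite !patchE.
  case: ifPn => xK; first by rewrite mem_set//; exact/KD/set_mem.
  by case: ifPn => // _; rewrite phi0 ?mulr0//; move: xK; rewrite notin_setE.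
have := @integrableMl _ _ _ mu K mK (EFin \o g) phi gi.
apply; first exact: continuous_measurable_fun_cV.
exists M; split; first exact: num_real.
by move=> N MN x Kx; apply: le_trans (ltW MN); exact: phiM.
Qed.

Lemma test_function_out D phi x : test_function D phi ->
  ~ closure [set x | phi x != 0%R] x -> phi x = 0%R.
Proof.
move=> _ nx; apply: contrapT => /eqP phix; apply: nx.
exact: subset_closure.
Qed.

Lemma integrable_loc_test D g phi : measurable D -> loc_integrable D g ->
  test_function D phi -> mu.-integrable D (fun x => (g x * phi x)%:E).
Proof.
move=> mD lg tphi; have [sphi cK KD] := tphi.
apply: (integrable_loc_mul mD lg _ cK KD); first exact: smooth_continuous.
by move=> x; exact: test_function_out tphi.
Qed.

Lemma integrable_loc_partial_test D g phi j : measurable D -> loc_integrable D g ->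
  test_function D phi -> mu.-integrable D (fun x => (g x * partial j phi x)%:E).
Proof.
move=> mD lg tphi; have [sphi cK KD] := tphi.
apply: (integrable_loc_mul mD lg _ cK KD); first exact: smooth_partial_continuous.
apply: partial_out; first exact: closed_closure.
by move=> x; exact: test_function_out tphi.
Qed.

Lemma loc_integrableB D f g : measurable D -> loc_integrable D f -> loc_integrable D g ->
  loc_integrable D (fun x => f x - g x)%R.
Proof.
move=> mD lf lg; split; first by apply: measurable_funB; [case: lf|case: lg].
move=> K cK KD; have := integrableB (compact_measurable_cV cK)
  (loc_integrable_compact mD lf cK KD) (loc_integrable_compact mD lg cK KD).
by move/integrableP => [].
Qed.

Lemma weak_partialB D j f1 g1 f2 g2 : measurable D ->
  weak_partial D j f1 g1 -> weak_partial D j f2 g2 ->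
  weak_partial D j (fun x => f1 x - f2 x)%R (fun x => g1 x - g2 x)%R.
Proof.
move=> mD [lf1 lg1 E1] [lf2 lg2 E2]; split; [exact: loc_integrableB..|].
move=> phi tphi.
under eq_integral do rewrite mulrBl EFinB.
under [in RHS]eq_integral do rewrite mulrBl EFinB.
rewrite !integralB_EFin//; try exact: integrable_loc_partial_test;
  try exact: integrable_loc_test.
rewrite E1// E2// oppeB ?oppeK//.
apply: fin_num_adde_defr; apply: (integrable_fin_num mD).
exact: integrable_loc_test.
Qed.

(** The difference of the two derivatives is orthogonal to all test functions. *)
Lemma weak_partial_unique D j f g1 g2 : open D ->
  weak_partial D j f g1 -> weak_partial D j f g2 -> ae_eq mu D g1 g2.
Proof.
move=> oD w1 w2; have mD := open_measurable_cV oD.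
have [_ lg E] := weak_partialB mD w1 w2.
have := fundamental_lemma oD lg.
have h phi : test_function D phi ->
    \int[mu]_(x in D) ((g1 x - g2 x)%R * phi x)%:E = 0.
  move=> tphi; apply: oppe_inj; rewrite -E// oppe0.
  by under eq_integral do rewrite subrr mul0r; rewrite integral0.
move=> /(_ h); apply: filterS => x /= g12 Dx.
by apply/eqP; rewrite -subr_eq0; apply/eqP; exact: g12.
Qed.

(** Integration by parts: the product has compact support in [D], so its partial
    derivative integrates to 0. *)
Lemma integral_partialM D K j f g : measurable D ->
  (forall x, derivable f x (delta_mx j 0%R)) -> continuous f ->
  continuous (partial j f) ->
  (forall x, derivable g x (delta_mx j 0%R)) -> continuous g ->
  continuous (partial j g) ->
  compact K -> K `<=` D -> (forall x, ~ K x -> g x = 0%R) ->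
  \int[mu]_(x in D) (f x * partial j g x)%:E =
  - \int[mu]_(x in D) (partial j f x * g x)%:E.
Proof.
move=> mD df cf cpf dg cg cpg cK KD g0.
have pg0 := @partial_out _ _ j g K (compact_closed_cV cK) g0.
have i1 := integrable_loc_mul mD (continuous_loc_integrable D cf) cpg cK KD pg0.
have i2 := integrable_loc_mul mD (continuous_loc_integrable D cpf) cg cK KD g0.
have pfg := partialM df dg.
have : \int[mu]_(x in D) (partial j (fun x => f x * g x)%R x)%:E = 0.
  apply: (integral_partial_supp _ _ cK KD).
  - by move=> x; exact: derivableM.
  - by rewrite pfg; exact: (continuous_addr (continuous_mulr cf cpg)
      (continuous_mulr cg cpf)).
  - by move=> x /g0 ->; rewrite mulr0.
rewrite pfg; under eq_integral do rewrite [(g _ * _)%R]mulrC EFinD.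
rewrite integralD_EFin//.
rewrite -(fineK (integrable_fin_num mD i1)) -(fineK (integrable_fin_num mD i2)).
by rewrite -EFinD => -[/eqP]; rewrite addr_eq0 => /eqP ->.
Qed.

Lemma C1_weak_partial D j f : measurable D ->
  (forall x, derivable f x (delta_mx j 0%R)) -> continuous f ->
  continuous (partial j f) -> weak_partial D j f (partial j f).
Proof.
move=> mD df cf cpf; split; [exact: continuous_loc_integrable..|].
move=> phi tphi; have [sphi cK KD] := tphi.
apply: (integral_partialM mD df cf cpf _ _ _ cK KD).
- by move=> x; exact: smooth_derivable.
- exact: smooth_continuous.
- exact: smooth_partial_continuous.
- by move=> x; exact: test_function_out tphi.
Qed.

End weak_partial_theory.

Section weak_gradient_theory.
Context {R : realType} {n k : nat}.
Local Notation mu := (@lebesgue_cV R n).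
Implicit Types (D : set 'cV[R]_n) (W : 'cV[R]_n -> 'cV[R]_k).

Lemma is_weak_gradientB D W1 G1 W2 G2 : measurable D ->
  is_weak_gradient D W1 G1 -> is_weak_gradient D W2 G2 ->
  is_weak_gradient D (fun x => W1 x - W2 x) (fun x => G1 x - G2 x).
Proof.
move=> mD w1 w2 i j; have := weak_partialB mD (w1 i j) (w2 i j).
by congr weak_partial; apply/funext => x; rewrite !mxE.
Qed.

Lemma is_weak_gradient_unique D W G1 G2 : open D ->
  is_weak_gradient D W G1 -> is_weak_gradient D W G2 -> ae_eq mu D G1 G2.
Proof.
move=> oD w1 w2.
have : \forall x \ae mu, forall ij : 'I_k * 'I_n, D x -> G1 x ij.1 ij.2 = G2 x ij.1 ij.2.
  by apply: filter_forall => -[i j]; exact: weak_partial_unique (w1 i j) (w2 i j).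
by apply: filterS => x E Dx; apply/matrixP => i j; exact: (E (i, j)).
Qed.

Lemma weak_gradient_ae D W G : open D -> is_weak_gradient D W G ->
  ae_eq mu D (weak_gradient D W) G.
Proof.
move=> oD wG; apply: (is_weak_gradient_unique oD _ wG).
exact: (@xgetPex _ (fun=> 0) [set G | is_weak_gradient D W G] (ex_intro _ G wG)).
Qed.

End weak_gradient_theory.

(** * Symmetry of second derivatives *)

Section schwarz.
Context {R : realType} {n : nat}.
Implicit Types (f : 'cV[R]_n -> R) (x y : 'cV[R]_n) (i j : 'I_n).
Local Notation e i := (@delta_mx R n 1 i 0).

Lemma mean_value_line f i y (h : R) : (forall x, derivable f x (e i)) -> 0 < h ->
  exists2 c, 0 < c < h & f (h *: e i + y) - f y = partial i f (c *: e i + y) * h.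
Proof.
move=> df h0; pose g (s : R) := f (s *: e i + y).
have E (s : R) := @derive_comp_line R _ R^o _ f (fun s : R => s *: e i + y) (e i) 1 s.
have dg (s : R) : is_derive s 1 g (partial i f (s *: e i + y)).
  have [|d1 d2] := E s.
    by move=> t; rewrite scalerDl [t%:A]mulr1 addrA.
  by apply: DeriveDef; [rewrite d1; exact: df|exact: d2].
have cg : {within `[0, h], continuous g}.
  apply: continuous_subspaceT => s.
  by apply/differentiable_continuous/derivable1_diffP; case: (dg s).
have [c] := MVT h0 (fun s _ => dg s) cg.
rewrite in_itv/= /g scale0r add0r subr0 => ch E'.
by exists c.
Qed.

Lemma partial_shift f i (v : 'cV[R]_n) x : (forall x, derivable f x (e i)) ->
  derivable (fun z => f (v + z)) x (e i) /\
  partial i (fun z => f (v + z)) x = partial i f (v + x).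
Proof.
move=> df; have [|d1 d2] := @derive_comp_line R _ _ _ f (fun z => v + z) (e i) (e i) x.
  by move=> h; rewrite addrCA.
by split; [rewrite [derivable _ _ _]d1; exact: df|exact: d2].
Qed.

(** The mean value theorem in each direction in turn; the left-hand side is
    symmetric in [i] and [j], which is the source of the symmetry of second
    derivatives. *)
Lemma second_difference f i j x (h : R) : smooth f -> 0 < h ->
  exists c d, [/\ 0 < c < h, 0 < d < h &
    f (h *: e i + (h *: e j + x)) - f (h *: e i + x) - (f (h *: e j + x) - f x) =
    partial j (partial i f) (d *: e j + (c *: e i + x)) * h * h].
Proof.
move=> sf h0; have df y : derivable f y (e i) by exact: smooth_derivable.
pose F z := f (h *: e j + z) - f z.
have dF y : derivable F y (e i).
  exact: (derivableB (partial_shift (h *: e j) y df).1 (df y)).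
have [c ch Fc] := mean_value_line x dF h0.
have pF y : partial i F y = partial i f (h *: e j + y) - partial i f y.
  have [d1 d2] := partial_shift (h *: e j) y df.
  by rewrite -d2; exact: (deriveB d1 (df y)).
have dpf y : derivable (partial i f) y (e j).
  by apply: smooth_derivable; exact: smooth_partial.
have [d dh pd] := mean_value_line (c *: e i + x) dpf h0.
exists c, d; split=> //.
rewrite -pd -pF -Fc /F.
by rewrite [h *: e j + (h *: e i + x)]addrCA; ring.
Qed.

Lemma cV_delta_norm_le i : `|e i| <= 1.
Proof. by apply: cV_norm_le => // k; rewrite mxE; case: (_ && _); rewrite ?normr1 ?normr0. Qed.

(** Two continuous functions that take a common value at points arbitrarily close
    to [x] agree at [x]; the points have the form given by [second_difference]. *)
Lemma eq_second_difference (A B : 'cV[R]_n -> R) i j x :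
  continuous A -> continuous B ->
  (forall h : R, 0 < h -> exists c d c' d' : R,
    [/\ 0 < c < h, 0 < d < h, 0 < c' < h & 0 < d' < h] /\
    A (d *: e j + (c *: e i + x)) = B (d' *: e i + (c' *: e j + x))) ->
  A x = B x.
Proof.
move=> cA cB AB.
apply/eqP; rewrite -subr_eq0 -normr_le0; apply/ler_addgt0Pl => eps eps0; rewrite addr0.
have eps20 : 0 < eps / 2 by rewrite divr_gt0.
have /cvgrPdist_lt/(_ _ eps20) hA := cA x.
have /cvgrPdist_lt/(_ _ eps20) hB := cB x.
have hAB : nbhs x [set t | `|A x - A t| < eps / 2 /\ `|B x - B t| < eps / 2].
  exact: filterI hA hB.
move/nbhs_ballP : hAB => [r /= r0 xr].
(* The points of AB lie within 2 * h of x, and 2 * (r / 4) < r. *)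
pose h := r / 4; have h0 : 0 < h by rewrite divr_gt0.
have inball (a b : 'I_n) (s t : R) : 0 < s < h -> 0 < t < h ->
    ball x r (s *: e a + (t *: e b + x)).
  move=> /andP[s0 sh] /andP[t0 th]; rewrite mx_norm_ball /ball_ /=.
  rewrite -normrN opprB addrA addrK; apply: le_lt_trans (ler_normD _ _) _.
  rewrite !normrZ (gtr0_norm s0) (gtr0_norm t0).
  have := cV_delta_norm_le a; have := cV_delta_norm_le b.
  rewrite /h in sh th; move: `|_| `|_| => u v; nra.
have [c [d [c' [d' [[ch dh ch' dh'] pq]]]]] := AB h h0.
set p := d *: _ + _ in pq; set q := d' *: _ + _ in pq.
have [Ap _] : `|A x - A p| < eps / 2 /\ `|B x - B p| < eps / 2.
  by apply: xr; exact: inball.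
have [_ Bq] : `|A x - A q| < eps / 2 /\ `|B x - B q| < eps / 2.
  by apply: xr; exact: inball.
rewrite -pq in Bq.
rewrite (_ : A x - B x = (A x - A p) - (B x - A p)); last by ring.
apply: le_trans (ler_normB _ _) _; rewrite [leRHS]splitr.
by rewrite lerD// ltW.
Qed.

Lemma partialC f i j : smooth f -> partial i (partial j f) = partial j (partial i f).
Proof.
move=> sf; apply/funext => x; apply/esym; apply: (@eq_second_difference _ _ i j).
- by apply: smooth_partial_continuous; exact: smooth_partial.
- by apply: smooth_partial_continuous; exact: smooth_partial.
move=> h h0.
have [c [d [ch dh E1]]] := second_difference i j x sf h0.
have [c' [d' [ch' dh' E2]]] := second_difference j i x sf h0.
exists c, d, c', d'; split; first by split.
have hh : h * h != 0 by rewrite mulf_neq0// gt_eqF.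
move: (partial j _ _) (partial i _ _) E1 E2 => a b E1 E2.
apply: (mulIf hh); rewrite !mulrA -E1 -E2.
by rewrite [h *: e j + (h *: e i + x)]addrCA; ring.
Qed.

Local Open Scope ereal_scope.

(** The difference of the two integrands is a null Lagrangian: moving both
    derivatives onto [v], the two integrals become the same up to the order of
    differentiation. This is how the squared divergence of a compactly supported
    field is compared with its Dirichlet energy. *)
Lemma integral_partial_swap (D : set 'cV[R]_n) (u v : 'cV[R]_n -> R) i j :
  measurable D -> test_function D u -> smooth v ->
  \int[lebesgue_cV n]_(x in D) (partial i v x * partial j u x)%:E =
  \int[lebesgue_cV n]_(x in D) (partial j v x * partial i u x)%:E.
Proof.
move=> mD tu sv; have [su cK KD] := tu.
have parts a b : \int[lebesgue_cV n]_(x in D) (partial a v x * partial b u x)%:E =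
    - \int[lebesgue_cV n]_(x in D) (partial b (partial a v) x * u x)%:E.
  have sav := smooth_partial a sv.
  apply: (integral_partialM mD _ _ _ _ _ _ cK KD).
  - by move=> x; exact: smooth_derivable.
  - exact: smooth_continuous.
  - exact: smooth_partial_continuous.
  - by move=> x; exact: smooth_derivable.
  - exact: smooth_continuous.
  - exact: smooth_partial_continuous.
  - by move=> x; exact: test_function_out tu.
by rewrite (parts i j) (parts j i) (partialC i j sv).
Qed.

End schwarz.

(** * Square-integrable functions and mean-square convergence *)

Lemma cvg_sumr {R : realType} (I : Type) (s : seq I) (u : I -> nat -> R) (a : I -> R) :
  (forall i, u i m @[m --> \oo] --> a i) ->
  \sum_(i <- s) u i m @[m --> \oo] --> \sum_(i <- s) a i.
Proof.
move=> ua; elim: s => [|i s ih].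
  by under eq_cvg do rewrite big_nil; rewrite big_nil; exact: cvg_cst.
by under eq_cvg do rewrite big_cons; rewrite big_cons; exact: cvgD (ua i) ih.
Qed.

Section integrable_real.
Context d (T : measurableType d) (R : realType).
Variables (mu : {measure set T -> \bar R}) (D : set T).
Hypothesis mD : measurable D.
Implicit Types f g : T -> R.

Lemma integrable_addr f g : mu.-integrable D (EFin \o f) ->
  mu.-integrable D (EFin \o g) -> mu.-integrable D (EFin \o (fun x => f x + g x)).
Proof. by move=> fi gi; have := integrableD mD fi gi. Qed.

Lemma integrable_mulrl (c : R) f : mu.-integrable D (EFin \o f) ->
  mu.-integrable D (EFin \o (fun x => c * f x)).
Proof. by move=> fi; have := integrableZl mD c fi. Qed.

Lemma integrable_sumr (I : Type) (s : seq I) (P : pred I) (F : I -> T -> R) :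
  (forall i, mu.-integrable D (EFin \o F i)) ->
  mu.-integrable D (EFin \o (fun x => \sum_(i <- s | P i) F i x)).
Proof.
move=> Fi; elim: s => [|i s ih].
  rewrite (_ : _ \o _ = cst 0%E); first exact: integrable0.
  by apply/funext => x /=; rewrite big_nil.
rewrite (_ : _ \o _ = EFin \o (fun x => (if P i then F i x else 0) +
    \sum_(j <- s | P j) F j x)).
  apply: integrable_addr => //; case: (P i) => //.
  exact: integrable0.
by apply/funext => x /=; rewrite big_cons; case: (P i); rewrite ?add0r.
Qed.

Lemma Rintegral_sum (I : Type) (s : seq I) (P : pred I) (F : I -> T -> R) :
  (forall i, mu.-integrable D (EFin \o F i)) ->
  \int[mu]_(x in D) (\sum_(i <- s | P i) F i x) =
  \sum_(i <- s | P i) \int[mu]_(x in D) F i x.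
Proof.
move=> Fi; elim: s => [|i s ih].
  rewrite big_nil; under eq_Rintegral do rewrite big_nil.
  by rewrite Rintegral_cst// mul0r.
rewrite big_cons; under eq_Rintegral do rewrite big_cons.
by case: (P i) => //; rewrite RintegralD// ?ih//; exact: integrable_sumr.
Qed.

End integrable_real.

Section square_integrable.
Context d (T : measurableType d) (R : realType).
Variables (mu : {measure set T -> \bar R}) (D : set T).
Hypotheses (mD : measurable D) (muD : (mu D < +oo)%E).
Implicit Types (f g : T -> R) (fn gn : nat -> T -> R).

Definition sqint f : Prop :=
  measurable_fun D f /\ mu.-integrable D (fun x => (f x ^+ 2)%:E).

Lemma sqint_dominated f g h : measurable_fun D f -> sqint g -> sqint h ->
  (forall x, D x -> `|f x| <= g x ^+ 2 + h x ^+ 2) ->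
  mu.-integrable D (fun x => (f x)%:E).
Proof.
move=> mf [_ ig] [_ ih] fgh.
apply: (le_integrable mD (g := fun x => (g x ^+ 2 + h x ^+ 2)%:E)).
- exact/measurable_EFinP.
- move=> x Dx; rewrite lee_fin; apply: le_trans (fgh x Dx) _; exact: ler_norm.
- by under eq_fun do rewrite EFinD; exact: integrableD.
Qed.

Lemma integrable_sqintM f g : sqint f -> sqint g ->
  mu.-integrable D (fun x => (f x * g x)%:E).
Proof.
move=> sf sg; apply: (sqint_dominated _ sf sg).
  by apply: measurable_funM; [case: sf|case: sg].
move=> x _; rewrite normrM -(real_normK (num_real (f x))) -(real_normK (num_real (g x))).
by have := sqr_ge0 (`|f x| - `|g x|); have := normr_ge0 (f x); have := normr_ge0 (g x);
  move: `|f x| `|g x| => a b; nra.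
Qed.

Lemma sqint_bounded f (M : R) : measurable_fun D f ->
  (forall x, D x -> `|f x| <= M) -> sqint f.
Proof.
move=> mf fM; split => //; apply: measurable_bounded_integrable => //.
  exact: measurable_funX.
exists (M ^+ 2); split; first exact: num_real.
move=> N MN x Dx; apply: le_trans (ltW MN); rewrite normrX.
by rewrite ler_sqr ?nnegrE ?fM// (le_trans _ (fM x Dx)).
Qed.

Lemma sqint_cst (c : R) : sqint (fun=> c).
Proof. by apply: (@sqint_bounded _ `|c|). Qed.

Lemma sqint_integrable f : sqint f -> mu.-integrable D (EFin \o f).
Proof.
move=> sf; have := integrable_sqintM sf (sqint_cst 1).
by under eq_fun do rewrite mulr1.
Qed.

Lemma sqintD f g : sqint f -> sqint g -> sqint (fun x => f x + g x).
Proof.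
move=> sf sg; have mfg : measurable_fun D (fun x => f x + g x).
  by apply: measurable_funD; [case: sf|case: sg].
split=> //; have i3 := integrable_sqintM sf sg.
have [_ i1] := sf; have [_ i2] := sg.
have -> : (fun x => ((f x + g x) ^+ 2)%:E) =
    (fun x => (f x ^+ 2)%:E + (g x ^+ 2)%:E + ((f x * g x)%:E + (f x * g x)%:E))%E.
  by apply/funext => x; rewrite -!EFinD; congr _%:E; ring.
by apply: integrableD => //; exact: integrableD.
Qed.

Lemma sqintZ (c : R) f : sqint f -> sqint (fun x => c * f x).
Proof.
move=> [mf i]; split; first exact: measurable_funM.
have -> : (fun x => ((c * f x) ^+ 2)%:E) = (fun x => (c ^+ 2)%:E * (f x ^+ 2)%:E)%E.
  by apply/funext => x; rewrite exprMn EFinM.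
exact: integrableZl.
Qed.

Lemma sqintB f g : sqint f -> sqint g -> sqint (fun x => f x - g x).
Proof.
move=> sf /(sqintZ (-1)) sg; have := sqintD sf sg.
by under eq_fun do rewrite mulN1r.
Qed.

(** The integral of [(t * f + g) ^+ 2] is a quadratic polynomial in [t] that takes
    no negative value. *)
Lemma cauchy_schwarz_Rintegral f g : sqint f -> sqint g ->
  (\int[mu]_(x in D) (f x * g x)) ^+ 2 <=
  \int[mu]_(x in D) (f x ^+ 2) * \int[mu]_(x in D) (g x ^+ 2).
Proof.
move=> sf sg; have iff := sf.2; have igg := sg.2; have ifg := integrable_sqintM sf sg.
set A := \int[mu]_(x in D) (f x ^+ 2); set B := \int[mu]_(x in D) (g x ^+ 2).
set C := \int[mu]_(x in D) (f x * g x).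
have A0 : 0 <= A by apply: Rintegral_ge0 => x _; exact: sqr_ge0.
have quad (t : R) : 0 <= t ^+ 2 * A + 2 * t * C + B.
  have -> : t ^+ 2 * A + 2 * t * C + B = \int[mu]_(x in D) ((t * f x + g x) ^+ 2).
    have i1 := integrable_mulrl mD (t ^+ 2) iff.
    have i2 := integrable_mulrl mD (2 * t) ifg.
    rewrite -!RintegralZl// -RintegralD// -RintegralD//; last exact: integrable_addr.
    by apply: eq_Rintegral => x _; ring.
  by apply: Rintegral_ge0 => x _; exact: sqr_ge0.
have [A00|An0] := eqVneq A 0.
  have [->|Cn0] := eqVneq C 0; first by rewrite expr0n/= A00 mul0r.
  (* The polynomial is affine in t; at this t it takes the value -1. *)
  have := quad (- (B + 1) / (2 * C)); rewrite A00 mulr0 add0r.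
  have -> : 2 * (- (B + 1) / (2 * C)) * C + B = -1 by field.
  by rewrite leNgt ltrN10.
have Agt0 : 0 < A by rewrite lt_neqAle eq_sym An0.
(* The minimum point of the polynomial. *)
have := quad (- C / A).
have -> : (- C / A) ^+ 2 * A + 2 * (- C / A) * C + B = (A * B - C ^+ 2) / A by field.
by rewrite pmulr_lge0 ?invr_gt0// subr_ge0.
Qed.

Definition L2cvg fn f : Prop :=
  \int[mu]_(x in D) ((fn m x - f x) ^+ 2) @[m --> \oo] --> (0 : R).

Lemma L2cvg_cst f : L2cvg (fun=> f) f.
Proof.
rewrite /L2cvg; have -> : (fun m : nat => \int[mu]_(x in D) ((f x - f x) ^+ 2)) = fun=> 0.
  apply/funext => _; under eq_Rintegral do rewrite subrr expr0n/=.
  by rewrite Rintegral_cst// mul0r.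
exact: cvg_cst.
Qed.

(** Cauchy-Schwarz. *)
Lemma L2cvg0_mul (an bn : nat -> T -> R) (B : R) :
  (forall m, sqint (an m)) -> (forall m, sqint (bn m)) ->
  \int[mu]_(x in D) (an m x ^+ 2) @[m --> \oo] --> (0 : R) ->
  (\forall m \near \oo, \int[mu]_(x in D) (bn m x ^+ 2) <= B) ->
  \int[mu]_(x in D) (an m x * bn m x) @[m --> \oo] --> (0 : R).
Proof.
move=> sa sb a0 bB.
apply: (@norm_cvg0 _ R^o).
pose s (m : nat) := Num.sqrt (\int[mu]_(x in D) (an m x ^+ 2) * `|B|).
apply: (@squeeze_cvgr _ _ _ _ (fun=> 0) s).
- near=> m; rewrite normr_ge0/= -sqrtr_sqr ler_wsqrtr//.
  apply: le_trans (cauchy_schwarz_Rintegral (sa m) (sb m)) _.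
  apply: ler_wpM2l; first by apply: Rintegral_ge0 => x _; exact: sqr_ge0.
  by apply: le_trans (ler_norm _); near: m.
- exact: cvg_cst.
- have aB0 : \int[mu]_(x in D) (an m x ^+ 2) * `|B| @[m --> \oo] --> (0 : R).
    by rewrite -(mul0r `|B|); apply: cvgM a0 _; exact: cvg_cst.
  by rewrite -(@sqrtr0 R); exact: (cvg_comp _ _ aB0 (@sqrt_continuous R 0)).
Unshelve. all: by end_near. Qed.

(** Expand the product of the limits plus errors; each term with an error tends
    to 0 by Cauchy-Schwarz. *)
Lemma L2cvg_mul fn f gn g :
  (forall m, sqint (fn m)) -> sqint f -> (forall m, sqint (gn m)) -> sqint g ->
  L2cvg fn f -> L2cvg gn g ->
  \int[mu]_(x in D) (fn m x * gn m x) @[m --> \oo] -->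
  \int[mu]_(x in D) (f x * g x).
Proof.
move=> sfn sf sgn sg fnf gng.
have sdf m : sqint (fun x => fn m x - f x) by exact: sqintB.
have sdg m : sqint (fun x => gn m x - g x) by exact: sqintB.
have c1 : \int[mu]_(x in D) ((fn m x - f x) * (gn m x - g x)) @[m --> \oo] --> (0 : R).
  by apply: (L2cvg0_mul (B := 1) sdf sdg fnf); exact: (cvgr_le _ gng).
have c2 : \int[mu]_(x in D) ((fn m x - f x) * g x) @[m --> \oo] --> (0 : R).
  by apply: (L2cvg0_mul sdf (fun=> sg) fnf); exact: nearW (fun=> lexx _).
have c3 : \int[mu]_(x in D) ((gn m x - g x) * f x) @[m --> \oo] --> (0 : R).
  by apply: (L2cvg0_mul sdg (fun=> sf) gng); exact: nearW (fun=> lexx _).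
pose k := \int[mu]_(x in D) (f x * g x).
have -> : (fun m => \int[mu]_(x in D) (fn m x * gn m x)) =
    (fun m => \int[mu]_(x in D) ((fn m x - f x) * (gn m x - g x)) +
              \int[mu]_(x in D) ((fn m x - f x) * g x) +
              \int[mu]_(x in D) ((gn m x - g x) * f x) + k).
  apply/funext => m.
  have i1 := integrable_sqintM (sdf m) (sdg m).
  have i2 := integrable_sqintM (sdf m) sg.
  have i3 := integrable_sqintM (sdg m) sf.
  have i4 := integrable_sqintM sf sg.
  have i12 := integrable_addr mD i1 i2.
  rewrite -RintegralD// -RintegralD// -RintegralD//; last exact: integrable_addr.
  by apply: eq_Rintegral => x _; ring.
rewrite -/k -[X in _ --> X]add0r -[X in _ --> X + _]addr0 -[X in _ --> X + _ + _]addr0.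
by apply: cvgD; [apply: cvgD => //; exact: cvgD|exact: cvg_cst].
Qed.

Lemma L2cvg_lipschitz (I : finType) (gn : I -> nat -> T -> R) (g : I -> T -> R)
    fn f (C : R) :
  (forall i m, sqint (fun x => gn i m x - g i x)) ->
  (forall m, sqint (fun x => fn m x - f x)) ->
  (forall m x, D x ->
    (fn m x - f x) ^+ 2 <= C * \sum_i (gn i m x - g i x) ^+ 2) ->
  (forall i, L2cvg (gn i) (g i)) -> L2cvg fn f.
Proof.
move=> sg sf fC gg.
have cS : C * \sum_i \int[mu]_(x in D) ((gn i m x - g i x) ^+ 2) @[m --> \oo] --> (0 : R).
  rewrite -[X in _ --> X](mulr0 C); apply: cvgM; first exact: cvg_cst.
  rewrite -[X in _ --> X](@big1_eq _ 0 +%R I (index_enum I) predT).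
  by apply: cvg_sumr => i; exact: gg.
apply: (@squeeze_cvgr _ _ _ _ (fun=> 0)
  (fun m => C * \sum_i \int[mu]_(x in D) ((gn i m x - g i x) ^+ 2))) cS.
  near=> m; apply/andP; split; first by apply: Rintegral_ge0 => x _; exact: sqr_ge0.
  have ig i : mu.-integrable D (EFin \o (fun x => (gn i m x - g i x) ^+ 2)).
    by case: (sg i m).
  rewrite -Rintegral_sum// -RintegralZl//; last exact: integrable_sumr.
  apply: le_Rintegral => //; first by case: (sf m).
  - by apply: integrable_mulrl => //; exact: integrable_sumr.
  - by move=> x Dx; exact: fC.
exact: cvg_cst.
Unshelve. all: by end_near. Qed.

End square_integrable.

(** * A truncation of the identity near the origin *)

Section truncation.
Context {R : realType} {n : nat}.
Implicit Types (e : R) (w v : 'cV[R]_n) (i j k : 'I_n).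

Lemma norm2_cV w : norm2 w = \sum_i w i 0 ^+ 2.
Proof. by apply: eq_bigr => i _; rewrite big_ord1. Qed.

Lemma norm2_ge0 m p (A : 'M[R]_(m, p)) : 0 <= norm2 A.
Proof. by apply: sumr_ge0 => i _; apply: sumr_ge0 => j _; exact: sqr_ge0. Qed.

Lemma sqr_entry_le_norm2 m p (A : 'M[R]_(m, p)) (i : 'I_m) (j : 'I_p) :
  A i j ^+ 2 <= norm2 A.
Proof.
rewrite /norm2 (bigD1 i)//= (bigD1 j)//= -addrA lerDl addr_ge0//.
  by apply: sumr_ge0 => k _; exact: sqr_ge0.
by apply: sumr_ge0 => k _; apply: sumr_ge0 => l _; exact: sqr_ge0.
Qed.

Lemma norm2_eq0 w : (norm2 w == 0) = (w == 0).
Proof.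
apply/eqP/eqP => [w0|->]; last first.
  by rewrite norm2_cV big1// => i _; rewrite mxE expr0n.
apply/colP => i; rewrite mxE; apply/eqP; rewrite -sqrf_eq0 eq_le sqr_ge0 andbT.
by rewrite -w0 sqr_entry_le_norm2.
Qed.

Lemma norm_mul_le_norm2 w i j : `|w i 0| * `|w j 0| <= norm2 w.
Proof.
have := sqr_entry_le_norm2 w i 0; have := sqr_entry_le_norm2 w j 0.
rewrite -(real_normK (num_real (w i 0))) -(real_normK (num_real (w j 0))).
have := sqr_ge0 (`|w i 0| - `|w j 0|).
by move: `|w i 0| `|w j 0| (norm2 w) => a b c; nra.
Qed.

Lemma ler_sum_ord (F : 'I_n -> R) (c : R) : (forall k, F k <= c) ->
  \sum_k F k <= n%:R * c.
Proof.
by move=> Fc; rewrite mulr_natl -[X in _ *+ X]card_ord -sumr_const ler_sum.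
Qed.

Definition tr_den e w : R := (norm2 w + e ^+ 2)^-1.

(** Up to the factor [e ^+ 2], the map [w |-> e ^+ 2 * w / (|w| ^+ 2 + e ^+ 2)],
    which is the identity to first order at the origin and at most [e] in size
    everywhere. *)
Definition tr_map e i w : R := w i 0 * tr_den e w.

(** The Jacobian matrix of [e ^+ 2 * tr_map e]; the derivatives of [tr_den] are
    expressed through [tr_map], which keeps the estimates below polynomial. *)
Definition tr_jac e i j w : R :=
  e ^+ 2 * ((i == j)%:R * tr_den e w - 2 * (tr_map e i w * tr_map e j w)).

Section bounds.
Variable e : R.
Hypothesis e0 : 0 < e.

Lemma tr_den_arg_gt0 w : 0 < norm2 w + e ^+ 2.
Proof. by rewrite ltr_wpDl ?norm2_ge0// exprn_gt0. Qed.

Lemma tr_den_gt0 w : 0 < tr_den e w.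
Proof. by rewrite invr_gt0 tr_den_arg_gt0. Qed.

Lemma tr_denK w : tr_den e w * (norm2 w + e ^+ 2) = 1.
Proof. by rewrite mulVf// gt_eqF// tr_den_arg_gt0. Qed.

Lemma tr_den_le w : tr_den e w <= e^-1 ^+ 2.
Proof.
by rewrite /tr_den exprVn lef_pV2 ?posrE ?exprn_gt0 ?tr_den_arg_gt0// lerDr norm2_ge0.
Qed.

Lemma tr_den_le_norm2 w : tr_den e w * norm2 w <= 1.
Proof.
rewrite -[leRHS](tr_denK w) ler_pM2l ?tr_den_gt0// lerDl.
by rewrite exprn_ge0// ltW.
Qed.

Lemma tr_mapM_le w i j : `|tr_map e i w| * `|tr_map e j w| <= tr_den e w.
Proof.
rewrite !normrM (gtr0_norm (tr_den_gt0 w)).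
have := norm_mul_le_norm2 w i j; have := tr_den_le_norm2 w.
have := tr_den_gt0 w; have := normr_ge0 (w i 0); have := normr_ge0 (w j 0).
move: `|w i 0| `|w j 0| (norm2 w) (tr_den e w) => a b c r b0 a0 r0 rc abc.
have -> : a * r * (b * r) = r * (r * (a * b)) by ring.
rewrite ger_pMr//; apply: le_trans rc.
by rewrite ler_pM2l.
Qed.

Lemma tr_map_le w i : `|tr_map e i w| <= e^-1.
Proof.
rewrite -(@ler_pXn2r _ 2)// ?nnegrE ?invr_ge0 ?(ltW e0)//.
by rewrite expr2; apply: le_trans (tr_mapM_le w i i) (tr_den_le w).
Qed.

Lemma tr_jac_le w i j : `|tr_jac e i j w| <= 3 * (e ^+ 2 * tr_den e w).
Proof.
have e20 : 0 < e ^+ 2 by rewrite exprn_gt0.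
rewrite /tr_jac normrM (gtr0_norm e20) [leRHS]mulrCA ler_pM2l//.
apply: le_trans (ler_normB _ _) _.
have h1 : `|(i == j)%:R * tr_den e w| <= tr_den e w.
  rewrite normrM (gtr0_norm (tr_den_gt0 w)) ger0_norm//.
  by case: (i == j); rewrite ?mul1r// mul0r ltW// tr_den_gt0.
have h2 := tr_mapM_le w i j; rewrite -normrM in h2.
rewrite [`|2 * _|]normrM (@gtr0_norm _ 2)//.
have -> : 3 * tr_den e w = tr_den e w + 2 * tr_den e w by ring.
by rewrite lerD// ler_pM2l.
Qed.

Lemma tr_jac_le3 w i j : `|tr_jac e i j w| <= 3.
Proof.
apply: le_trans (tr_jac_le w i j) _; rewrite ger_pMr//.
by rewrite -ler_pdivlMl ?exprn_gt0// mulr1 -exprVn tr_den_le.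
Qed.

Lemma norm2B_le w v (dl : R) : (forall k, `|w k 0 - v k 0| <= dl) ->
  `|norm2 v - norm2 w| <= dl * \sum_k (`|w k 0| + `|v k 0|).
Proof.
move=> wv; rewrite !norm2_cV -sumrB; apply: le_trans (ler_norm_sum _ _ _) _.
rewrite mulr_sumr; apply: ler_sum => k _.
rewrite subr_sqr normrM distrC ler_pM//.
by rewrite addrC ler_normD.
Qed.

Lemma tr_denB w v : tr_den e w - tr_den e v =
  tr_den e w * tr_den e v * (norm2 v - norm2 w).
Proof.
rewrite -{1}[tr_den e w]mulr1 -{1}(tr_denK v) -{2}[tr_den e v]mulr1 -{1}(tr_denK w).
by ring.
Qed.

(** The entries of the Jacobian are polynomials in [tr_den e] and [tr_map e], which
    are bounded; so it is Lipschitz as soon as these are. *)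
Lemma tr_denB_le w v (dl : R) : 0 <= dl -> (forall k, `|w k 0 - v k 0| <= dl) ->
  `|tr_den e w - tr_den e v| <= 2 * n%:R * e^-1 ^+ 3 * dl.
Proof.
move=> dl0 wv; rewrite tr_denB !normrM !(gtr0_norm (tr_den_gt0 _)).
have rw := tr_den_gt0 w; have rv := tr_den_gt0 v.
apply: le_trans (_ : tr_den e w * tr_den e v *
    (dl * \sum_k (`|w k 0| + `|v k 0|)) <= _).
  by rewrite ler_pM2l ?mulr_gt0//; exact: norm2B_le.
rewrite mulrCA mulrC mulr_sumr.
rewrite ler_wpM2r// [2 * _]mulrC -mulrA; apply: ler_sum_ord => k.
have hw := tr_map_le w k; have hv := tr_map_le v k.
rewrite !normrM !(gtr0_norm (tr_den_gt0 _)) in hw hv.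
have -> : tr_den e w * tr_den e v * (`|w k 0| + `|v k 0|) =
  tr_den e v * (`|w k 0| * tr_den e w) + tr_den e w * (`|v k 0| * tr_den e v) by ring.
have -> : 2 * e^-1 ^+ 3 = e^-1 ^+ 2 * e^-1 + e^-1 ^+ 2 * e^-1 by ring.
by rewrite lerD// ler_pM ?mulr_ge0 ?(ltW rw) ?(ltW rv) ?tr_den_le.
Qed.

Lemma tr_mapB_le w v i (dl : R) : (forall k, `|w k 0 - v k 0| <= dl) ->
  `|tr_map e i w - tr_map e i v| <= (2 * n%:R + 1) * e^-1 ^+ 2 * dl.
Proof.
move=> wv; have rw := tr_den_gt0 w; have rv := tr_den_gt0 v.
have dl0 : 0 <= dl by apply: le_trans (wv i).
have -> : tr_map e i w - tr_map e i v = (w i 0 - v i 0) * tr_den e w +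
    v i 0 * (tr_den e w - tr_den e v) by rewrite /tr_map; ring.
apply: le_trans (ler_normD _ _) _.
rewrite addrC [(_ + 1) * _]mulrDl mul1r [leRHS]mulrDl lerD//; last first.
  by rewrite normrM (gtr0_norm rw) mulrC ler_pM ?(ltW rw) ?tr_den_le.
rewrite tr_denB !normrM !(gtr0_norm (tr_den_gt0 _)).
apply: le_trans (_ : `|v i 0| * (tr_den e w * tr_den e v *
    (dl * \sum_k (`|w k 0| + `|v k 0|))) <= _).
  by rewrite ler_wpM2l// ler_pM2l ?mulr_gt0//; exact: norm2B_le.
rewrite [leLHS](_ : _ = `|v i 0| * (tr_den e w * tr_den e v) *
  (\sum_k (`|w k 0| + `|v k 0|)) * dl); last by ring.
rewrite ler_wpM2r// mulr_sumr.
rewrite [2 * _]mulrC -mulrA; apply: ler_sum_ord => k.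
have hw := tr_map_le w k; have hv := tr_map_le v i; have hvv := tr_mapM_le v i k.
rewrite !normrM !(gtr0_norm (tr_den_gt0 _)) in hw hv hvv.
have -> : `|v i 0| * (tr_den e w * tr_den e v) * (`|w k 0| + `|v k 0|) =
  (`|v i 0| * tr_den e v) * (`|w k 0| * tr_den e w) +
  tr_den e w * (`|v i 0| * `|v k 0| * tr_den e v) by ring.
have -> : 2 * e^-1 ^+ 2 = e^-1 * e^-1 + e^-1 ^+ 2 * 1 by ring.
rewrite lerD// ler_pM ?mulr_ge0 ?(ltW rw) ?(ltW rv) ?tr_den_le//.
apply: le_trans (tr_den_le_norm2 v).
by rewrite [leRHS]mulrC ler_pM2r// norm_mul_le_norm2.
Qed.

Lemma tr_jacB_le w v i j (dl : R) : (forall k, `|w k 0 - v k 0| <= dl) ->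
  `|tr_jac e i j w - tr_jac e i j v| <= (10 * n%:R + 4) * e^-1 * dl.
Proof.
move=> wv; have dl0 : 0 <= dl by apply: le_trans (wv i).
have e20 : 0 < e ^+ 2 by rewrite exprn_gt0.
have eV0 : 0 < e^-1 by rewrite invr_gt0.
rewrite /tr_jac -mulrBr normrM (gtr0_norm e20).
have -> : (10 * n%:R + 4) * e^-1 * dl =
    e ^+ 2 * ((10 * n%:R + 4) * e^-1 ^+ 3 * dl) by field; rewrite gt_eqF.
rewrite ler_pM2l//.
have hr := tr_denB_le dl0 wv; have hi := tr_mapB_le i wv; have hj := tr_mapB_le j wv.
have bi := tr_map_le v i; have bj := tr_map_le w j.
set r := tr_den e w in hr *; set s := tr_den e v in hr *.
set ui := tr_map e i w in hi *; set vi := tr_map e i v in hi bi *.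
set uj := tr_map e j w in hj bj *; set vj := tr_map e j v in hj *.
clearbody r s ui vi uj vj.
have -> : (i == j)%:R * r - 2 * (ui * uj) - ((i == j)%:R * s - 2 * (vi * vj)) =
  (i == j)%:R * (r - s) - (2 * (ui - vi) * uj + 2 * vi * (uj - vj)) by ring.
apply: le_trans (ler_normB _ _) _.
have -> : (10 * n%:R + 4) * e^-1 ^+ 3 * dl = 2 * n%:R * e^-1 ^+ 3 * dl +
  (2 * ((2 * n%:R + 1) * e^-1 ^+ 2 * dl) * e^-1 +
   2 * e^-1 * ((2 * n%:R + 1) * e^-1 ^+ 2 * dl)) by ring.
apply: lerD.
  apply: le_trans hr; rewrite normrM ler_piMl// ger0_norm//.
  by case: (i == j).
apply: le_trans (ler_normD _ _) _.
rewrite !normrM (@gtr0_norm _ 2)//.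
by rewrite lerD// ler_pM ?mulr_ge0// ler_pM2l.
Qed.

Lemma tr_jacB_sqr_le w v i j : (tr_jac e i j w - tr_jac e i j v) ^+ 2 <=
  ((10 * n%:R + 4) * e^-1) ^+ 2 * \sum_k (w k 0 - v k 0) ^+ 2.
Proof.
have -> : \sum_k (w k 0 - v k 0) ^+ 2 = norm2 (w - v).
  by rewrite norm2_cV; apply: eq_bigr => k _; rewrite !mxE.
have wv k : `|w k 0 - v k 0| <= Num.sqrt (norm2 (w - v)).
  rewrite -sqrtr_sqr ler_wsqrtr//.
  by have := sqr_entry_le_norm2 (w - v) k 0; rewrite !mxE.
rewrite -(sqr_sqrtr (norm2_ge0 (w - v))) -exprMn -(real_normK (num_real (_ - _))).
rewrite ler_sqr ?nnegrE//; first exact: tr_jacB_le.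
by rewrite !mulr_ge0 ?sqrtr_ge0 ?invr_ge0 ?(ltW e0)// addr_ge0// mulr_ge0.
Qed.

End bounds.

Lemma tr_jac0 e i j : 0 < e -> tr_jac e i j 0 = (i == j)%:R.
Proof.
move=> e0; have n0 : norm2 (0 : 'cV[R]_n) = 0 by apply/eqP; rewrite norm2_eq0.
rewrite /tr_jac /tr_map /tr_den n0 add0r !mxE !mul0r mulr0 subr0.
by rewrite mulrCA divff ?mulr1// expf_neq0// gt_eqF.
Qed.

(** Off the origin [tr_den e w] stays below [(norm2 w)^-1], so the factor [e ^+ 2]
    prevails. *)
Lemma tr_jac_cvg i j w : tr_jac (@harmonic R m) i j w @[m --> \oo] -->
  ((w == 0)%:R * (i == j)%:R : R).
Proof.
have [->|w0] := eqVneq w 0.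
  by under eq_cvg do rewrite tr_jac0 ?harmonic_gt0//; rewrite mul1r; exact: cvg_cst.
rewrite mul0r; apply: (@norm_cvg0 _ R^o).
have N0 : 0 < norm2 w by rewrite lt_neqAle norm2_ge0 eq_sym norm2_eq0 w0.
pose s (m : nat) := 3 * (norm2 w)^-1 * (@harmonic R m * @harmonic R m).
apply: (@squeeze_cvgr _ _ _ _ (fun=> 0) s).
- near=> m; rewrite normr_ge0/=; have h0 := @harmonic_gt0 R m.
  apply: le_trans (tr_jac_le h0 w i j) _.
  rewrite /s -mulrA ler_pM2l// mulrC expr2 ler_pM2r ?mulr_gt0//.
  by rewrite lef_pV2 ?posrE ?tr_den_arg_gt0// lerDl exprn_ge0// ltW.
- exact: cvg_cst.
- rewrite -[X in _ --> X](mulr0 (3 * (norm2 w)^-1)); apply: cvgM; first exact: cvg_cst.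
  rewrite -[X in _ --> X](mulr0 0); apply: cvgM; exact: cvg_harmonic.
Unshelve. all: by end_near. Qed.

Lemma norm2_continuous : continuous (fun w : 'cV[R]_n => norm2 w).
Proof.
have -> : (fun w : 'cV[R]_n => norm2 w) =
    (fun w => \sum_(k <- index_enum 'I_n) w k 0 * w k 0).
  by apply/funext => w; rewrite norm2_cV; apply: eq_bigr => k _; rewrite expr2.
elim: (index_enum _) => [|k s ih].
  by under eq_fun do rewrite big_nil; exact: cst_continuous.
under eq_fun do rewrite big_cons.
by apply: continuous_addr => //; apply: continuous_mulr; exact: coord_cV_continuous.
Qed.

Lemma tr_den_continuous e : 0 < e -> continuous (tr_den e).
Proof.
move=> e0 w; apply: (@continuousV _ _ (fun w => norm2 w + e ^+ 2)).
  by rewrite gt_eqF// tr_den_arg_gt0.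
apply: (continuous_addr norm2_continuous); exact: cst_continuous.
Qed.

Lemma tr_map_continuous e i : 0 < e -> continuous (tr_map e i).
Proof.
move=> e0; apply: continuous_mulr; first exact: coord_cV_continuous.
exact: tr_den_continuous.
Qed.

Lemma tr_jac_continuous e i j : 0 < e -> continuous (tr_jac e i j).
Proof.
move=> e0.
have -> : tr_jac e i j = fun w => e ^+ 2 * ((i == j)%:R * tr_den e w +
    (- 2) * (tr_map e i w * tr_map e j w)).
  by apply/funext => w; rewrite /tr_jac mulNr.
apply: continuous_mulr; first exact: cst_continuous.
apply: continuous_addr; apply: continuous_mulr; try exact: cst_continuous.
  exact: tr_den_continuous.
by apply: continuous_mulr; exact: tr_map_continuous.
Qed.

Lemma tr_map_chain m e (V : 'cV[R]_m -> 'cV[R]_n) i (l : 'I_m) (x : 'cV[R]_m) : 0 < e ->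
  (forall k, derivable (fun y => V y k 0) x (delta_mx l 0)) ->
  derivable (fun y => e ^+ 2 * tr_map e i (V y)) x (delta_mx l 0) /\
  partial l (fun y => e ^+ 2 * tr_map e i (V y)) x =
  \sum_k tr_jac e i k (V x) * partial l (fun y => V y k 0) x.
Proof.
move=> e0 dV; set v := delta_mx l 0 in dV *.
pose dv k := partial l (fun y => V y k 0) x.
have isV k : is_derive x v (fun y => V y k 0) (dv k) by exact: derivableP.
have isN : is_derive x v (fun y => norm2 (V y) + e ^+ 2)
    (\sum_k 2 * V x k 0 * dv k).
  have -> : (fun y => norm2 (V y) + e ^+ 2) =
      \sum_(k < n) ((fun y => V y k 0) * (fun y => V y k 0)) + cst (e ^+ 2).
    apply/funext => y; rewrite /= norm2_cV fctE /= fct_sumE.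
    by congr (_ + _); apply: eq_bigr => k _; rewrite expr2.
  apply: is_derive_eq; rewrite addr0; apply: eq_bigr => k _.
  by rewrite /GRing.scale/=; ring.
have q0 : norm2 (V x) + e ^+ 2 != 0 by rewrite gt_eqF// tr_den_arg_gt0.
have isD : is_derive x v (fun y => tr_den e (V y))
    (- (tr_den e (V x) ^+ 2) * \sum_k 2 * V x k 0 * dv k).
  apply: DeriveDef; first by apply: derivableV => //; case: isN.
  rewrite (@deriveV _ _ (fun y => norm2 (V y) + e ^+ 2))//.
  by case: isN => _ ->; rewrite /GRing.scale/= /tr_den exprVn.
have [dM eM] : is_derive x v (fun y => e ^+ 2 * tr_map e i (V y))
    (\sum_k tr_jac e i k (V x) * dv k).
  have isM := is_deriveM (is_derive_cst (e ^+ 2) x v) (is_deriveM (isV i) isD).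
  apply: (is_derive_eq isM); rewrite /GRing.scale/= mulr0 addr0.
  transitivity (\sum_k e ^+ 2 * ((i == k)%:R * tr_den e (V x) * dv k -
      2 * (tr_map e i (V x) * tr_map e k (V x)) * dv k)); last first.
    by apply: eq_bigr => k _; rewrite /tr_jac; ring.
  rewrite -mulr_sumr; congr (_ * _); rewrite sumrB addrC; congr (_ + _).
    rewrite (bigD1 i)//= eqxx mul1r big1 ?addr0// => k ki.
    by rewrite eq_sym (negbTE ki) !mul0r.
  rewrite -sumrN mulr_sumr mulr_sumr; apply: eq_bigr => k _.
  by rewrite /tr_map; ring.
by split.
Qed.

End truncation.

(** * The energy inequality *)

(** The pointwise form of the energy inequality, with [P] the gradient of the
    perturbation and [a] telling whether the point is in the given set. With [t]
    the trace of [P], it says that [\sum_i \sum_j P i j ^+ 2] is at least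
    [\sum_i \sum_j P i j * P j i - t ^+ 2 - a * (n ^+ 2 + 2 * n * t)]: the first
    sum dominates that of the products [P i j * P j i], and
    [t ^+ 2 + n ^+ 2 + 2 * n * t] is the square of [n + t]. *)
Lemma sum_sqr_delta_ge {R : realType} n (P : 'I_n -> 'I_n -> R) (a : bool) :
  n%:R * 1 + n%:R ^+ 2 * a%:R +
    - (2 * n%:R) * \sum_i (a%:R * ((i == i)%:R + P i i)) +
    (2 * \sum_i P i i + \sum_i \sum_j (P i j * P j i - P i i * P j j)) <=
  \sum_i \sum_j ((i == j)%:R + P i j) * ((i == j)%:R + P i j).
Proof.
set t := \sum_i P i i.
have -> : \sum_i (a%:R * ((i == i)%:R + P i i)) = a%:R * (n%:R + t).
  under eq_bigr do rewrite eqxx.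
  by rewrite -mulr_sumr big_split/= sumr_const card_ord.
have -> : \sum_i \sum_j (P i j * P j i - P i i * P j j) =
    \sum_i \sum_j P i j * P j i - t ^+ 2.
  rewrite expr2 {1}/t mulr_suml -sumrB; apply: eq_bigr => i _.
  by rewrite mulr_sumr -sumrB.
have -> : \sum_i \sum_j ((i == j)%:R + P i j) * ((i == j)%:R + P i j) =
    n%:R + 2 * t + \sum_i \sum_j P i j ^+ 2.
  rewrite /t mulr_sumr -[n%:R]/(1 *+ n) -[X in 1 *+ X]card_ord -sumr_const.
  rewrite -!big_split/=; apply: eq_bigr => i _.
  transitivity (\sum_j ((i == j)%:R * (1 + 2 * P i j) + P i j ^+ 2)).
    by apply: eq_bigr => j _; case: (i == j) => /=; ring.
  rewrite big_split/= (bigD1 i)//= eqxx mul1r big1 ?addr0// => j ji.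
  by rewrite eq_sym (negbTE ji) mul0r.
have sq : \sum_i \sum_j P i j * P j i <= \sum_i \sum_j P i j ^+ 2.
  have : 0 <= \sum_i \sum_j (P i j - P j i) ^+ 2.
    by apply: sumr_ge0 => i _; apply: sumr_ge0 => j _; exact: sqr_ge0.
  have -> : \sum_i \sum_j (P i j - P j i) ^+ 2 =
      \sum_i \sum_j P i j ^+ 2 + \sum_j \sum_i P i j ^+ 2 -
      2 * \sum_i \sum_j P i j * P j i.
    rewrite mulr_sumr -big_split -sumrB/=; apply: eq_bigr => i _.
    by rewrite mulr_sumr -big_split -sumrB/=; apply: eq_bigr => j _; ring.
  rewrite [X in _ + X - _]exchange_big/=.
  by move: (\sum_i _) (\sum_i _) => x y; lra.
have : 0 <= (a%:R * n%:R + t) ^+ 2 by exact: sqr_ge0.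
case: a => /=; move: sq; move: (\sum_i _) (\sum_i _) (n%:R : R) => x y c sq; nra.
Qed.

Lemma indic_set1 {R : realType} (T : eqType) (a x : T) :
  \1_[set a] x = (x == a)%:R :> R.
Proof.
rewrite indicE; congr (_%:R); congr nat_of_bool.
by apply/idP/eqP => [/set_mem|->] //; exact: mem_set.
Qed.

Section core.
Context {R : realType} {n : nat}.
Local Notation mu := (@lebesgue_cV R n).
Variables (D : set 'cV[R]_n) (rho : R).
Hypotheses (oD : open D) (Drho : D `<=` cbox (const_mx (- rho)) (const_mx rho)).
Implicit Types (Phi W : 'cV[R]_n -> 'cV[R]_n) (i j k : 'I_n).

Let mD : measurable D := open_measurable_cV oD.

Let muD : (mu D < +oo)%E.
Proof. exact: lebesgue_cV_bounded_lty Drho. Qed.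

Let ci f : continuous f -> mu.-integrable D (EFin \o f).
Proof. by move=> cf; exact: (continuous_integrable_bounded cf mD Drho). Qed.

Lemma continuous_sqint f : continuous f -> sqint mu D f.
Proof.
move=> cf; split; first exact: continuous_measurable_fun_cV.
by apply: ci; have := continuous_mulr cf cf; under eq_fun do rewrite -expr2.
Qed.

Definition test_field Phi := forall i, test_function D (fun x => Phi x i 0).

Definition jac Phi i j (x : 'cV[R]_n) : R := partial j (fun y => Phi y i 0) x.

(** The Jacobian matrix of [x + Phi x]. *)
Definition djac Phi i j (x : 'cV[R]_n) : R := (i == j)%:R + jac Phi i j x.

Lemma jac_continuous Phi i j : test_field Phi -> continuous (jac Phi i j).
Proof. by move=> tP; apply: smooth_partial_continuous; case: (tP i). Qed.

Lemma djac_continuous Phi i j : test_field Phi -> continuous (djac Phi i j).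
Proof.
by move=> tP; apply: continuous_addr; [exact: cst_continuous|exact: jac_continuous].
Qed.

Lemma Rintegral_jac Phi i j : test_field Phi -> \int[mu]_(x in D) jac Phi i j x = 0.
Proof.
move=> tP; have [sP cK KD] := tP i; rewrite /Rintegral.
rewrite (integral_partial_supp _ _ cK KD)//.
- by move=> x; exact: smooth_derivable.
- exact: jac_continuous.
- by move=> x; exact: test_function_out (tP i).
Qed.

(** Hence the integral of [\sum_i \sum_j jac Phi i j * jac Phi j i] is that of the
    squared divergence of [Phi]. *)
Lemma Rintegral_jac_swap Phi i j : test_field Phi ->
  \int[mu]_(x in D) (jac Phi i j x * jac Phi j i x - jac Phi i i x * jac Phi j j x) = 0.
Proof.
move=> tP; have cj := fun a b => @jac_continuous Phi a b tP.
rewrite RintegralB//; [|by apply: ci; exact: continuous_mulr..].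
have [si _ _] := tP i.
have E : \int[mu]_(x in D) (jac Phi i j x * jac Phi j i x) =
         \int[mu]_(x in D) (jac Phi i i x * jac Phi j j x) :=
  congr1 fine (integral_partial_swap j i mD (tP j) si).
by rewrite E subrr.
Qed.

(** The terms of [sum_sqr_delta_ge] that do not appear here, collected in [Z] in
    the proof, integrate to 0: they are a divergence and null Lagrangians. *)
Lemma energy_test_field Phi (A : set 'cV[R]_n) : test_field Phi -> measurable A ->
  n%:R * \int[mu]_(x in D) 1 + n%:R ^+ 2 * \int[mu]_(x in D) \1_A x -
    2 * n%:R * \sum_i \int[mu]_(x in D) (\1_A x * djac Phi i i x) <=
  \sum_i \sum_j \int[mu]_(x in D) (djac Phi i j x * djac Phi i j x).
Proof.
move=> tP mA.
have cj := fun a b => @jac_continuous Phi a b tP.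
have cN := fun a b => @djac_continuous Phi a b tP.
have iN a b : mu.-integrable D (EFin \o (fun x => djac Phi a b x * djac Phi a b x)).
  by apply: ci; exact: continuous_mulr.
have sA : sqint mu D (\1_A : _ -> R).
  apply: (@sqint_bounded _ _ _ _ _ mD muD _ 1); first exact: measurable_indic.
  by move=> x _; rewrite indicE; case: (_ \in _); rewrite ?normr1 ?normr0.
have iA : mu.-integrable D (EFin \o (\1_A : _ -> R)) by exact: sqint_integrable.
have iAN i : mu.-integrable D (EFin \o (fun x => \1_A x * djac Phi i i x)).
  by apply: integrable_sqintM => //; exact: continuous_sqint.
have i1 : mu.-integrable D (EFin \o (fun _ : 'cV[R]_n => 1 : R)).
  by apply: ci; exact: cst_continuous.
pose L x := n%:R * 1 + n%:R ^+ 2 * \1_A x +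
  - (2 * n%:R) * \sum_i (\1_A x * djac Phi i i x).
pose Z x := 2 * \sum_i jac Phi i i x +
  \sum_i \sum_j (jac Phi i j x * jac Phi j i x - jac Phi i i x * jac Phi j j x).
have iZ1 i j : mu.-integrable D (EFin \o (fun x =>
    jac Phi i j x * jac Phi j i x - jac Phi i i x * jac Phi j j x)).
  have := integrableB mD (ci (continuous_mulr (cj i j) (cj j i)))
                         (ci (continuous_mulr (cj i i) (cj j j))).
  by [].
have iS1 : mu.-integrable D (EFin \o (fun x => \sum_i jac Phi i i x)).
  by apply: (@integrable_sumr _ _ _ _ _ mD) => i; exact: ci.
have iS2 : mu.-integrable D (EFin \o (fun x => \sum_i \sum_j
    (jac Phi i j x * jac Phi j i x - jac Phi i i x * jac Phi j j x))).
  by do 2![apply: (@integrable_sumr _ _ _ _ _ mD) => ?].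
have iZ : mu.-integrable D (EFin \o Z).
  by apply: (integrable_addr mD) => //; exact: integrable_mulrl.
have Z0 : \int[mu]_(x in D) Z x = 0.
  rewrite RintegralD//; last exact: integrable_mulrl.
  rewrite RintegralZl// Rintegral_sum//; last by move=> i; exact: ci.
  rewrite big1; last by move=> i _; exact: Rintegral_jac.
  rewrite mulr0 add0r Rintegral_sum//; last first.
    by move=> i; exact: integrable_sumr.
  rewrite big1// => i _; rewrite Rintegral_sum// big1// => j _.
  exact: Rintegral_jac_swap.
have iS3 : mu.-integrable D (EFin \o (fun x => \sum_i (\1_A x * djac Phi i i x))).
  exact: integrable_sumr.
have iL12 : mu.-integrable D (EFin \o (fun x => n%:R * 1 + n%:R ^+ 2 * \1_A x)).
  by apply: (integrable_addr mD); exact: integrable_mulrl.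
have iL : mu.-integrable D (EFin \o L).
  by apply: (integrable_addr mD) => //; exact: integrable_mulrl.
have -> : n%:R * \int[mu]_(x in D) 1 + n%:R ^+ 2 * \int[mu]_(x in D) \1_A x -
    2 * n%:R * \sum_i \int[mu]_(x in D) (\1_A x * djac Phi i i x) =
    \int[mu]_(x in D) (L x + Z x).
  rewrite RintegralD// Z0 addr0 /L RintegralD//; last exact: integrable_mulrl.
  rewrite RintegralD//; [|exact: integrable_mulrl..].
  rewrite (RintegralZl _ mD i1) (RintegralZl _ mD iA) (RintegralZl _ mD iS3).
  by rewrite Rintegral_sum// mulNr.
have -> : \sum_i \sum_j \int[mu]_(x in D) (djac Phi i j x * djac Phi i j x) =
    \int[mu]_(x in D) (\sum_i \sum_j djac Phi i j x * djac Phi i j x).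
  rewrite Rintegral_sum//; last by move=> i; exact: integrable_sumr.
  by apply: eq_bigr => i _; rewrite Rintegral_sum.
apply: le_Rintegral => //.
- exact: integrable_addr.
- by do 2![apply: (@integrable_sumr _ _ _ _ _ mD) => ?].
move=> x _; rewrite /L /Z indicE.
exact: (sum_sqr_delta_ge (fun i j => jac Phi i j x)).
Qed.

Lemma derive_coord k i (x : 'cV[R]_n) :
  derivable (fun y : 'cV[R]_n => y k 0) x (delta_mx i 0) /\
  partial i (fun y : 'cV[R]_n => y k 0) x = (k == i)%:R.
Proof.
have [|d1 d2] := @derive_comp_line R R^o _ R^o id (fun y : 'cV[R]_n => y k 0)
    ((k == i)%:R : R^o) (delta_mx i 0) x.
  by move=> h; rewrite !mxE eqxx andbT.
split; first by rewrite [derivable _ _ _]d1; exact: derivable_id.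
by rewrite [LHS]d2 derive_id.
Qed.

Lemma derive_deformation Phi k i (x : 'cV[R]_n) : test_field Phi ->
  derivable (fun y => (y + Phi y) k 0) x (delta_mx i 0) /\
  partial i (fun y => (y + Phi y) k 0) x = djac Phi k i x.
Proof.
move=> tP; have [dk pk] := derive_coord k i x.
have dP : derivable (fun y => Phi y k 0) x (delta_mx i 0).
  by apply: smooth_derivable; case: (tP k).
have -> : (fun y => (y + Phi y) k 0) = (fun y => y k 0 + Phi y k 0).
  by apply/funext => y; rewrite mxE.
split; first exact: (derivableD dk dP).
by rewrite /djac -pk; exact: (deriveD dk dP).
Qed.

Lemma deformation_continuous Phi : test_field Phi ->
  continuous (fun y : 'cV[R]_n => y + Phi y).
Proof.
move=> tP; apply: continuous_cV => k.
have -> : (fun y => (y + Phi y) k 0) = (fun y => y k 0 + Phi y k 0).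
  by apply/funext => y; rewrite mxE.
apply: continuous_addr; first exact: coord_cV_continuous.
by apply: smooth_continuous; case: (tP k).
Qed.

(** The divergence of the truncated map composed with [x + Phi x] has the same
    integral as for [Phi = 0], since the two fields agree near the boundary. *)
Lemma tr_jac_balance Phi (e : R) : 0 < e -> test_field Phi ->
  \sum_i \sum_k \int[mu]_(x in D) (tr_jac e i k (x + Phi x) * djac Phi k i x) =
  \sum_i \int[mu]_(x in D) tr_jac e i i x.
Proof.
move=> e0 tP; apply: eq_bigr => i _.
pose K := \big[setU/set0]_k closure [set x | Phi x k 0 != 0].
have cK : compact K by apply: bigsetU_compact => k _; case: (tP k).
have KD : K `<=` D.
  rewrite /K; elim/big_ind : _ => // [A B AD BD|k _]; last by case: (tP k).
  by move=> x [/AD|/BD].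
have Phi0 x : ~ K x -> Phi x = 0.
  move=> Kx; apply/colP => k; rewrite mxE; apply: (test_function_out (tP k)).
  by apply: contra_not Kx => Kx; rewrite /K (bigD1 k)//=; left.
have cV := deformation_continuous tP.
have cT k : continuous (fun x : 'cV[R]_n => tr_jac e i k (x + Phi x)).
  move=> x; apply: (@continuous_comp _ _ _ (fun y : 'cV[R]_n => y + Phi y)); first exact: cV.
  exact: tr_jac_continuous.
have cTN k : continuous (fun x : 'cV[R]_n => tr_jac e i k (x + Phi x) * djac Phi k i x).
  by apply: continuous_mulr => //; exact: djac_continuous.
have E1 x := @tr_map_chain _ _ _ e (fun y : 'cV[R]_n => y + Phi y) i i x e0
  (fun k => (derive_deformation k i x tP).1).
have E2 x := @tr_map_chain _ _ _ e id i i x e0 (fun k => (derive_coord k i x).1).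
pose u (x : 'cV[R]_n) := e ^+ 2 * tr_map e i (x + Phi x) - e ^+ 2 * tr_map e i x.
have pu x : partial i u x =
    \sum_k tr_jac e i k (x + Phi x) * djac Phi k i x - tr_jac e i i x.
  rewrite /partial (deriveB (E1 x).1 (E2 x).1); congr (_ - _).
    rewrite [LHS](E1 x).2; apply: eq_bigr => k _.
    by rewrite (derive_deformation k i x tP).2.
  rewrite [LHS](E2 x).2 (bigD1 i)//= (derive_coord i i x).2 eqxx mulr1 big1 ?addr0//.
  by move=> k ki; rewrite (derive_coord k i x).2 (negbTE ki) mulr0.
have cS : continuous (fun x : 'cV[R]_n => \sum_k tr_jac e i k (x + Phi x) * djac Phi k i x).
  elim: (index_enum _) => [|k s ih].
    by under eq_fun do rewrite big_nil; exact: cst_continuous.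
  by under eq_fun do rewrite big_cons; exact: continuous_addr.
have ct : continuous (fun x : 'cV[R]_n => tr_jac e i i x) by exact: tr_jac_continuous.
have pu' : partial i u = fun x : 'cV[R]_n =>
    \sum_k tr_jac e i k (x + Phi x) * djac Phi k i x + - 1 * tr_jac e i i x.
  by apply/funext => x; rewrite pu mulN1r.
have : \int[mu]_(x in D) partial i u x = 0.
  rewrite /Rintegral (integral_partial_supp _ _ cK KD)//.
  - by move=> x; exact: (derivableB (E1 x).1 (E2 x).1).
  - rewrite pu'; apply: continuous_addr => //.
    by apply: continuous_mulr => //; exact: cst_continuous.
  - by move=> x /Phi0 P0; rewrite /u P0 addr0 subrr.
rewrite pu' RintegralD//; [|exact: ci|]; last first.
  by apply: integrable_mulrl => //; exact: ci.
rewrite RintegralZl//; last exact: ci.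
rewrite Rintegral_sum//; last by move=> k; exact: ci.
by move=> /eqP; rewrite mulN1r subr_eq0 => /eqP.
Qed.

Lemma Rintegral_dominated_cvg (fn : nat -> 'cV[R]_n -> R) (f g : 'cV[R]_n -> R) :
  (forall m, measurable_fun D (fn m)) -> measurable_fun D f ->
  (forall x, D x -> fn m x @[m --> \oo] --> f x) ->
  mu.-integrable D (EFin \o g) ->
  (forall m x, D x -> `|fn m x| <= g x) ->
  \int[mu]_(x in D) fn m x @[m --> \oo] --> \int[mu]_(x in D) f x.
Proof.
move=> mfn mf fnf ig fng.
have [|||||fi _ h] := @dominated_convergence _ _ _ mu D mD
  (fun m x => (fn m x)%:E) (fun x => (f x)%:E) (fun x => (g x)%:E).
- by move=> m; exact/measurable_EFinP.
- exact/measurable_EFinP.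
- by apply: aeW => x Dx; apply: cvg_EFin; [exact: nearW|exact: fnf].
- exact: ig.
- by apply: aeW => x m Dx; rewrite lee_fin; exact: fng.
apply: fine_cvg; rewrite fineK//; exact: (integrable_fin_num mD fi).
Qed.

Section limit.
Variables (W : 'cV[R]_n -> 'cV[R]_n) (M : 'I_n -> 'I_n -> 'cV[R]_n -> R).
Variable Phi_ : nat -> 'cV[R]_n -> 'cV[R]_n.
Hypotheses (n0 : (0 < n)%N) (mW : measurable_fun D W).
Hypothesis sM : forall i j, sqint mu D (M i j).
Hypothesis tPhi : forall m, test_field (Phi_ m).
Hypothesis sdW : forall i m, sqint mu D (fun x => (x + Phi_ m x) i 0 - W x i 0).
Hypothesis cvg_W : forall i,
  L2cvg mu D (fun m x => (x + Phi_ m x) i 0) (fun x => W x i 0).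
Hypothesis cvg_N : forall i j, L2cvg mu D (fun m x => djac (Phi_ m) i j x) (M i j).

Let mTW e i j : 0 < e -> measurable_fun D (fun x => tr_jac e i j (W x)).
Proof.
move=> e0; apply: measurableT_comp mW.
by apply: continuous_measurable_fun_cV; exact: tr_jac_continuous.
Qed.

Let sTW e i j : 0 < e -> sqint mu D (fun x => tr_jac e i j (W x)).
Proof.
move=> e0; apply: (@sqint_bounded _ _ _ _ _ mD muD _ 3); first exact: mTW.
by move=> x _; exact: tr_jac_le3.
Qed.

Let sTV e i j m : 0 < e -> sqint mu D (fun x => tr_jac e i j (x + Phi_ m x)).
Proof.
move=> e0; apply: continuous_sqint => x.
apply: (@continuous_comp _ _ _ (fun y : 'cV[R]_n => y + Phi_ m y)).
  exact: deformation_continuous.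
exact: tr_jac_continuous.
Qed.

Let sN i j m : sqint mu D (djac (Phi_ m) i j).
Proof. by apply: continuous_sqint; exact: djac_continuous. Qed.

(** The balance survives the passage to the limit because the Jacobian of the
    truncation is bounded and Lipschitz. *)
Lemma tr_jac_balance_lim e : 0 < e ->
  \sum_i \sum_k \int[mu]_(x in D) (tr_jac e i k (W x) * M k i x) =
  \sum_i \int[mu]_(x in D) tr_jac e i i x.
Proof.
move=> e0; set c := RHS.
have cvgT i k : L2cvg mu D (fun m x => tr_jac e i k (x + Phi_ m x))
    (fun x => tr_jac e i k (W x)).
  apply: (@L2cvg_lipschitz _ _ _ _ _ mD 'I_n (fun k m x => (x + Phi_ m x) k 0)
    (fun k x => W x k 0) _ _ (((10 * n%:R + 4) * e^-1) ^+ 2)) => //.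
  - by move=> m; apply: sqintB => //; [exact: sTV|exact: sTW].
  - by move=> m x _; exact: tr_jacB_sqr_le.
have lim1 : \sum_i \sum_k \int[mu]_(x in D)
    (tr_jac e i k (x + Phi_ m x) * djac (Phi_ m) k i x) @[m --> \oo] -->
    \sum_i \sum_k \int[mu]_(x in D) (tr_jac e i k (W x) * M k i x).
  apply: cvg_sumr => i; apply: cvg_sumr => k.
  apply: (L2cvg_mul mD) => //; [by move=> m; exact: sTV|exact: sTW].
have lim2 : \sum_i \sum_k \int[mu]_(x in D)
    (tr_jac e i k (x + Phi_ m x) * djac (Phi_ m) k i x) @[m --> \oo] --> c.
  by under eq_cvg do rewrite tr_jac_balance//; exact: cvg_cst.
exact: (cvg_unique _ lim1 lim2).
Qed.

Let A : set 'cV[R]_n := D `&` W @^-1` [set 0].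

Let mA : measurable A.
Proof.
by apply: mW => //; exact: measurable_set1_cV.
Qed.

Let A_W0 x : D x -> \1_A x = (W x == 0)%:R :> R.
Proof.
move=> Dx; rewrite indicE; congr (_%:R); congr nat_of_bool.
by apply/idP/eqP => [/set_mem[]|W0] //; apply/mem_set.
Qed.

Let sIA : sqint mu D (\1_A : _ -> R).
Proof.
apply: (@sqint_bounded _ _ _ _ _ mD muD _ 1) => // x _.
by rewrite indicE; case: (_ \in _); rewrite ?normr1 ?normr0.
Qed.

(** A Sobolev gradient vanishes almost everywhere on the zero set of the function;
    of this only the integrated trace is needed. The balance equates two
    integrals of the truncated map; as its scale tends to 0 one of them tends to
    the integral of the trace over the zero set of [W], the other to [n] times
    the measure of the zero set of the identity, a point. *)
Lemma Rintegral_trace_zero_set :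
  \sum_i \int[mu]_(x in D) (\1_A x * M i i x) = 0.
Proof.
pose e m := @harmonic R m; have e0 m : 0 < e m by exact: harmonic_gt0.
have lim1 : \sum_i \sum_k \int[mu]_(x in D) (tr_jac (e m) i k (W x) * M k i x)
    @[m --> \oo] -->
    \sum_i \sum_k \int[mu]_(x in D) (\1_A x * (i == k)%:R * M k i x).
  apply: cvg_sumr => i; apply: cvg_sumr => k.
  have mM : measurable_fun D (M k i) by case: (sM k i).
  apply: (Rintegral_dominated_cvg (g := fun x => 3 * `|M k i x|)).
  - by move=> m; apply: measurable_funM => //; exact: mTW.
  - by apply: measurable_funM => //; exact: measurable_funM.
  - move=> x Dx; rewrite (A_W0 Dx); apply: cvgM; last exact: cvg_cst.
    exact: tr_jac_cvg.
  - apply: (integrable_mulrl mD).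
    by have := integrable_abse (sqint_integrable mD muD (sM k i)).
  - by move=> m x _; rewrite normrM ler_wpM2r// tr_jac_le3.
have lim2 : \sum_i \int[mu]_(x in D) tr_jac (e m) i i x @[m --> \oo] -->
    \sum_(i < n) \int[mu]_(x in D) (((x == 0)%:R * (i == i)%:R) : R).
  apply: cvg_sumr => i.
  have mZ : measurable_fun D (fun x : 'cV[R]_n => ((x == 0)%:R * (i == i)%:R) : R).
    apply: measurable_funM => //.
    rewrite (_ : (fun x => _) = \1_[set 0]); last first.
      by apply/funext => x; rewrite indic_set1.
    by apply: measurable_indic; exact: measurable_set1_cV.
  apply: (Rintegral_dominated_cvg (g := fun x => 3)) => //.
  - move=> m; apply: continuous_measurable_fun_cV; exact: tr_jac_continuous.
  - by move=> x _; exact: tr_jac_cvg.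
  - by apply: ci; exact: cst_continuous.
  - by move=> m x _; exact: tr_jac_le3.
have z0 : \sum_(i < n) \int[mu]_(x in D) (((x == 0)%:R * (i == i)%:R) : R) = 0.
  rewrite big1// => i _.
  have -> : (fun x : 'cV[R]_n => (x == 0)%:R * (i == i)%:R : R) = \1_[set 0].
    by apply/funext => x; rewrite indic_set1 eqxx mulr1.
  rewrite /Rintegral integral_indic//; last exact: measurable_set1_cV.
  rewrite (_ : mu _ = 0%E)//; apply/eqP; rewrite -measure_le0.
  rewrite -(@lebesgue_cV_set1_0 R n n0); apply: le_measure; rewrite ?inE//.
  - by apply: measurableI => //; exact: measurable_set1_cV.
  - exact: measurable_set1_cV.
rewrite z0 in lim2.
have E : (fun m => \sum_i \sum_k \int[mu]_(x in D) (tr_jac (e m) i k (W x) * M k i x)) =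
    (fun m => \sum_i \int[mu]_(x in D) tr_jac (e m) i i x).
  by apply/funext => m; exact: tr_jac_balance_lim.
rewrite E in lim1; rewrite -[RHS](cvg_unique _ lim1 lim2)//.
apply: eq_bigr => i _; rewrite (bigD1 i)//= eqxx.
under [in RHS]eq_Rintegral do rewrite mulr1.
rewrite big1 ?addr0// => k ki.
rewrite eq_sym (negbTE ki); under eq_Rintegral do rewrite mulr0 mul0r.
by rewrite Rintegral_cst// mul0r.
Qed.

(** In the limit the linear term of [energy_test_field], taken over the zero set
    of [W], disappears. *)
Lemma energy_ge :
  n%:R * \int[mu]_(x in D) 1 + n%:R ^+ 2 * \int[mu]_(x in D) \1_A x <=
  \sum_i \sum_j \int[mu]_(x in D) (M i j x * M i j x).
Proof.
set l := leLHS.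
have lim1 : l - 2 * n%:R * \sum_i \int[mu]_(x in D) (\1_A x * djac (Phi_ m) i i x)
    @[m --> \oo] --> l.
  have tr0 : \sum_i \int[mu]_(x in D) (\1_A x * djac (Phi_ m) i i x) @[m --> \oo] -->
      \sum_i \int[mu]_(x in D) (\1_A x * M i i x).
    apply: cvg_sumr => i; apply: (L2cvg_mul mD) => //.
    exact: L2cvg_cst.
  rewrite Rintegral_trace_zero_set in tr0.
  rewrite -[X in _ --> X]subr0 -[X in _ --> _ - X](mulr0 (2 * n%:R)).
  by apply: cvgB; [exact: cvg_cst|apply: cvgM tr0; exact: cvg_cst].
have lim2 : \sum_i \sum_j \int[mu]_(x in D) (djac (Phi_ m) i j x * djac (Phi_ m) i j x)
    @[m --> \oo] --> \sum_i \sum_j \int[mu]_(x in D) (M i j x * M i j x).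
  apply: cvg_sumr => i; apply: cvg_sumr => j.
  exact: (L2cvg_mul mD).
apply: (ler_cvg_to lim1 lim2); apply: nearW => m.
exact: energy_test_field.
Qed.

End limit.

End core.

(** * The identity is a global minimizer *)

Section competitors.
Context {R : realType} {n : nat}.
Local Notation mu := (@lebesgue_cV R n).
Implicit Types (D : set 'cV[R]_n).

Lemma open_Rd_ball (r : R) : open (@Rd_ball R n r).
Proof.
rewrite (_ : Rd_ball r = (fun x : 'cV[R]_n => norm2 x) @^-1` `]-oo, (r ^+ 2)[).
  by apply: open_comp => [x _|]; [exact: norm2_continuous|exact: interval_open].
by apply/seteqP; split => x; rewrite /Rd_ball /= in_itv.
Qed.

Lemma Rd_ball_sub_cbox (r : R) : 0 < r ->
  @Rd_ball R n r `<=` cbox (const_mx (- r)) (const_mx r).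
Proof.
move=> r0 x xr i; rewrite !mxE -ler_norml.
rewrite -(@ler_pXn2r _ 2)// ?nnegrE ?(ltW r0)// real_normK ?num_real//.
exact: le_trans (sqr_entry_le_norm2 x i 0) (ltW xr).
Qed.

Lemma measurable_fun_mx_on (d : measure_display) (T : measurableType d) (m p : nat)
    (E : set T) (f : T -> 'M[R]_(m, p)) : measurable E ->
  (forall i j, measurable_fun E (fun x => f x i j)) -> measurable_fun E f.
Proof.
move=> mE mf.
apply: (@measurability _ _ _ _ E f (@mx_cylinders _ R m p)) => //.
by move=> _ [_ [i [j [B mB ->]]] <-]; exact: mf.
Qed.

Lemma measurable_norm2 (m p : nat) D (F : 'cV[R]_n -> 'M[R]_(m, p)) :
  (forall i j, measurable_fun D (fun x => F x i j)) ->
  measurable_fun D (fun x => norm2 (F x)).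
Proof.
move=> mF; rewrite /norm2; apply: measurable_sum => i.
by apply: measurable_sum => j; apply: measurable_funX.
Qed.

Lemma L2_sqint (m p : nat) D (F : 'cV[R]_n -> 'M[R]_(m, p)) i j :
  measurable D -> L2 D F -> sqint mu D (fun x => F x i j).
Proof.
move=> mD [mF iF].
have mFij a b : measurable_fun D (fun x => F x a b).
  exact: (measurableT_comp (@measurable_mxentry _ R m p a b) mF).
split=> //; apply/integrableP; split.
  by apply/measurable_EFinP; exact: measurable_funX.
apply: le_lt_trans iF; apply: ge0_le_integral => //.
- by do 2!apply: measurableT_comp => //; exact: measurable_funX.
- by apply/measurable_EFinP; exact: measurable_norm2.
- by move=> x _; rewrite lee_fin ger0_norm ?sqr_ge0// sqr_entry_le_norm2.
Qed.

Lemma continuous_L2 (m p : nat) D (rho : R) (F : 'cV[R]_n -> 'M[R]_(m, p)) :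
  measurable D -> D `<=` cbox (const_mx (- rho)) (const_mx rho) ->
  (forall i j, continuous (fun x => F x i j)) -> L2 D F.
Proof.
move=> mD Drho cF; split.
  by apply: measurable_fun_mx_on => // i j; exact: continuous_measurable_fun_cV.
have ci i j : mu.-integrable D (EFin \o (fun x => F x i j ^+ 2)).
  apply: (continuous_integrable_bounded _ mD Drho).
  by have := continuous_mulr (cF i j) (cF i j); under eq_fun do rewrite -expr2.
have : mu.-integrable D (EFin \o (fun x => norm2 (F x))).
  by rewrite /norm2; do 2![apply: (@integrable_sumr _ _ _ _ _ mD) => ?].
move=> /integrableP[_]; apply: le_lt_trans; rewrite le_eqVlt; apply/orP; left.
by apply/eqP; apply: eq_integral => x _ /=; rewrite ger0_norm ?norm2_ge0.
Qed.

Lemma is_weak_gradient_id D : measurable D ->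
  is_weak_gradient D (fun x : 'cV[R]_n => x) (fun=> 1%:M : 'M[R]_n).
Proof.
move=> mD i j.
have -> : (fun x : 'cV[R]_n => (1%:M : 'M[R]_n) i j) =
    partial j (fun x : 'cV[R]_n => x i 0).
  by apply/funext => x; rewrite mxE (derive_coord i j x).2.
apply: C1_weak_partial => //.
- by move=> x; exact: (derive_coord i j x).1.
- exact: coord_cV_continuous.
- rewrite (_ : partial j _ = fun=> (i == j)%:R); first exact: cst_continuous.
  by apply/funext => x; rewrite (derive_coord i j x).2.
Qed.

Lemma is_weak_gradient0 D : measurable D ->
  is_weak_gradient D (fun _ : 'cV[R]_n => 0 : 'cV[R]_n) (fun=> 0 : 'M[R]_n).
Proof.
move=> mD i j.
have -> : (fun x : 'cV[R]_n => (0 : 'M[R]_n) i j) =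
    partial j (fun x : 'cV[R]_n => (0 : 'cV[R]_n) i 0).
  by apply/funext => x; rewrite /partial derive_cst mxE.
apply: C1_weak_partial => //.
- exact: cst_continuous.
- rewrite (_ : partial j _ = fun=> 0); first exact: cst_continuous.
  by apply/funext => x; exact: derive_cst.
Qed.

Lemma is_weak_gradientD D (W1 W2 : 'cV[R]_n -> 'cV[R]_n) G1 G2 : measurable D ->
  is_weak_gradient D W1 G1 -> is_weak_gradient D W2 G2 ->
  is_weak_gradient D (fun x => W1 x + W2 x) (fun x => G1 x + G2 x).
Proof.
move=> mD w1 w2.
have := is_weak_gradientB mD w1 (is_weak_gradientB mD (is_weak_gradient0 mD) w2).
by under eq_fun do rewrite sub0r opprK; under [X in is_weak_gradient _ _ X]eq_fun do
  rewrite sub0r opprK.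
Qed.

Lemma is_weak_gradient_test D Phi : measurable D -> test_field D Phi ->
  is_weak_gradient D Phi (fun x => \matrix_(i, j) jac Phi i j x).
Proof.
move=> mD tP i j; have [sP _ _] := tP i.
have -> : (fun x => (\matrix_(i, j) jac Phi i j x) i j) =
    partial j (fun x => Phi x i 0).
  by apply/funext => x; rewrite mxE.
apply: C1_weak_partial => //.
- by move=> x; exact: smooth_derivable.
- exact: smooth_continuous.
- exact: smooth_partial_continuous.
Qed.

Lemma measurable_is_weak_gradient D (W : 'cV[R]_n -> 'cV[R]_n) G i j :
  is_weak_gradient D W G -> measurable_fun D (fun x => G x i j).
Proof. by move=> /(_ i j)[_ []]. Qed.

(** The energy may be computed from any weak gradient, whichever one
    [weak_gradient] selects. *)
Lemma integral_norm2_weak_gradient D (W : 'cV[R]_n -> 'cV[R]_n) G : open D ->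
  is_weak_gradient D W G ->
  (\int[mu]_(x in D) (norm2 (weak_gradient D W x))%:E =
   \int[mu]_(x in D) (norm2 (G x))%:E)%E.
Proof.
move=> oD wG; have wW : is_weak_gradient D W (weak_gradient D W).
  exact: (@xgetPex _ (fun=> 0) [set G | is_weak_gradient D W G] (ex_intro _ G wG)).
apply: ae_eq_integral.
- exact: open_measurable_cV.
- apply/measurable_EFinP; apply: measurable_norm2 => i j.
  exact: measurable_is_weak_gradient wW.
- apply/measurable_EFinP; apply: measurable_norm2 => i j.
  exact: measurable_is_weak_gradient wG.
- by apply: filterS (weak_gradient_ae oD wG) => x E Dx; rewrite E.
Qed.

End competitors.

Section identity_minimizer.
Context {R : realType} {n : nat}.
Hypothesis n0 : (0 < n)%N.
Local Notation mu := (@lebesgue_cV R n).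
Local Notation Idn := (1%:M : 'M[R]_n).

Lemma norm2_scalar1 : norm2 Idn = n%:R.
Proof.
rewrite /norm2 -[n in RHS]card_ord -sumr_const; apply: eq_bigr => i _.
rewrite (bigD1 i)//= big1 ?addr0 => [|j ji]; rewrite mxE ?eqxx ?expr1n//.
by rewrite eq_sym (negbTE ji) expr0n.
Qed.

Section bounded_domain.
Variables (D : set 'cV[R]_n) (rho : R).
Hypotheses (oD : open D) (Drho : D `<=` cbox (const_mx (- rho)) (const_mx rho)).

Let mD : measurable D := open_measurable_cV oD.

Let muD : (mu D < +oo)%E.
Proof. exact: lebesgue_cV_bounded_lty Drho. Qed.

Lemma H1_id : H1 D (fun x : 'cV[R]_n => x).
Proof.
split.
  by apply: (continuous_L2 mD Drho) => i j; rewrite ord1; exact: coord_cV_continuous.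
exists (fun=> Idn); first exact: is_weak_gradient_id.
by apply: (continuous_L2 mD Drho) => i j; exact: cst_continuous.
Qed.

Lemma H10_approx (W : 'cV[R]_n -> 'cV[R]_n) G : H10 D W -> is_weak_gradient D W G ->
  exists Phi_ : nat -> 'cV[R]_n -> 'cV[R]_n, forall m, test_field D (Phi_ m) /\
    (\int[mu]_(x in D) (norm2 (Phi_ m x - W x))%:E +
     \int[mu]_(x in D) (norm2 (\matrix_(i, j) jac (Phi_ m) i j x - G x))%:E
       < m.+1%:R^-1%:E)%E.
Proof.
move=> [_ H] wG; have [m|Phi_ h] := @choice _ _ (fun (m : nat) Phi => test_field D Phi /\
    (\int[mu]_(x in D) (norm2 (Phi x - W x))%:E +
     \int[mu]_(x in D) (norm2 (\matrix_(i, j) jac Phi i j x - G x))%:E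
       < m.+1%:R^-1%:E)%E); last by exists Phi_.
have [|Phi tP] := H m.+1%:R^-1; first by rewrite invr_gt0.
exists Phi; split=> //.
rewrite -(integral_norm2_weak_gradient oD
  (is_weak_gradientB mD (is_weak_gradient_test mD tP) wG)).
done.
Qed.

Lemma L2cvg_norm2 (p q : nat) (F_ : nat -> 'cV[R]_n -> 'M[R]_(p, q)) i j
    (fn : nat -> 'cV[R]_n -> R) f :
  (forall m, measurable_fun D (fun x => norm2 (F_ m x))) ->
  (forall m, sqint mu D (fun x => F_ m x i j)) ->
  (forall m, (\int[mu]_(x in D) (norm2 (F_ m x))%:E < m.+1%:R^-1%:E)%E) ->
  (forall m x, F_ m x i j = fn m x - f x) -> L2cvg mu D fn f.
Proof.
move=> mF sF iF Fij.
apply: (@squeeze_cvgr _ _ _ _ (fun=> 0) (@harmonic R)).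
- near=> m; apply/andP; split; first by apply: Rintegral_ge0 => x _; exact: sqr_ge0.
  have [_ /integrableP[mi ii]] := sF m.
  have E : (\int[mu]_(x in D) ((fn m x - f x) ^+ 2)%:E =
            \int[mu]_(x in D) (F_ m x i j ^+ 2)%:E)%E.
    by apply: eq_integral => x _; rewrite Fij.
  rewrite /Rintegral E -lee_fin fineK; last first.
    by apply: (integrable_fin_num mD); case: (sF m).
  apply: le_trans (ltW (iF m)); apply: ge0_le_integral => //.
  + by move=> x _; rewrite lee_fin sqr_ge0.
  + exact/measurable_EFinP.
  + by move=> x _; rewrite lee_fin sqr_entry_le_norm2.
- exact: cvg_cst.
- exact: cvg_harmonic.
Unshelve. all: by end_near. Qed.

(** The energy inequality for the identity plus test fields passes to competitors
    by density: [W] is the mean-square limit of such fields, and so is its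
    gradient. The left-hand side bounds the energy of the identity on [D]. *)
Lemma energy_competitor (W : 'cV[R]_n -> 'cV[R]_n) : H10 D (fun x => W x - x) ->
  (n%:R%:E * mu D + (n%:R ^+ 2)%:E * mu D <=
   \int[mu]_(x in D) (norm2 (weak_gradient D W x))%:E +
   (n%:R ^+ 2)%:E * mu ([set x | W x != 0%R] `&` D))%E.
Proof.
move=> H; have [[L2phi [G wG L2G]] _] := H.
have [Phi_ Phi_P] := H10_approx H wG.
have tPhi m : test_field D (Phi_ m) by case: (Phi_P m).
have wW : is_weak_gradient D W (fun x => G x + Idn).
  have := is_weak_gradientD mD wG (is_weak_gradient_id mD).
  by under eq_fun do rewrite subrK.
rewrite (integral_norm2_weak_gradient oD wW).
(* M is the gradient of the competitor W, djac (Phi_ m) that of its approximation. *)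
pose M i j (x : 'cV[R]_n) := (G x + Idn) i j.
have mphi i : measurable_fun D (fun x => (W x - x) i 0).
  by case: (L2_sqint i 0 mD L2phi).
have mW : measurable_fun D W.
  apply: measurable_fun_mx_on => // i j; rewrite ord1.
  have -> : (fun x => W x i 0) = (fun x => (W x - x) i 0 + x i 0).
    by apply/funext => x; rewrite !mxE subrK.
  apply: measurable_funD => //.
  by apply: continuous_measurable_fun_cV; exact: coord_cV_continuous.
have sG i j : sqint mu D (fun x => G x i j) by exact: L2_sqint.
have sM i j : sqint mu D (M i j).
  have := sqintD mD (sG i j) (sqint_cst mD muD (Idn i j)).
  by congr sqint; apply/funext => x; rewrite /M [in RHS]mxE.
have dWE i m x : (Phi_ m x - (W x - x)) i 0 = (x + Phi_ m x) i 0 - W x i 0.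
  by rewrite !mxE; ring.
have cPhi m i : continuous (fun x => Phi_ m x i 0).
  by apply: smooth_continuous; case: (tPhi m i).
have sdW i m : sqint mu D (fun x => (x + Phi_ m x) i 0 - W x i 0).
  have := sqintB mD (continuous_sqint oD Drho (cPhi m i)) (L2_sqint i 0 mD L2phi).
  by congr sqint; apply/funext => x; rewrite -dWE !mxE.
have dNE i j m x : (\matrix_(i, j) jac (Phi_ m) i j x - G x) i j =
    djac (Phi_ m) i j x - M i j x.
  by rewrite /djac /M !mxE; ring.
have sdN i j m : sqint mu D (fun x => djac (Phi_ m) i j x - M i j x).
  apply: sqintB => //; apply: (continuous_sqint oD Drho).
  by apply: (djac_continuous (D := D)); exact: tPhi.
have cvgW i : L2cvg mu D (fun m x => (x + Phi_ m x) i 0) (fun x => W x i 0).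
  apply: (L2cvg_norm2 (F_ := fun m x => Phi_ m x - (W x - x)) (i := i) (j := 0)).
  - move=> m; apply: measurable_norm2 => a b; rewrite ord1.
    under eq_fun do rewrite dWE; by case: (sdW a m).
  - by move=> m; under eq_fun do rewrite dWE.
  - move=> m; have [_] := Phi_P m; apply: le_lt_trans; rewrite leeDl//.
    by apply: integral_ge0 => x _; rewrite lee_fin norm2_ge0.
  - by move=> m x; rewrite dWE.
have cvgN i j : L2cvg mu D (fun m x => djac (Phi_ m) i j x) (M i j).
  apply: (L2cvg_norm2 (F_ := fun m x => \matrix_(i, j) jac (Phi_ m) i j x - G x)
    (i := i) (j := j)).
  - move=> m; apply: measurable_norm2 => a b.
    under eq_fun do rewrite dNE; by case: (sdN a b m).
  - by move=> m; under eq_fun do rewrite dNE.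
  - move=> m; have [_] := Phi_P m; apply: le_lt_trans; rewrite leeDr//.
    by apply: integral_ge0 => x _; rewrite lee_fin norm2_ge0.
  - by move=> m x; rewrite dNE.
have := energy_ge oD Drho n0 mW sM tPhi sdW cvgW cvgN.
set A := D `&` W @^-1` [set 0].
have mA : measurable A by apply: mW => //; exact: measurable_set1_cV.
have muA : (mu A < +oo)%E.
  by apply: le_lt_trans muD; apply: le_measure; rewrite ?inE//; exact: subIsetl.
have -> : [set x | W x != 0] `&` D = D `\` A.
  apply/seteqP; split => x /= [].
    by move=> /eqP Wx Dx; split=> // -[].
  by move=> Dx nA; split=> //; apply/eqP => Wx; apply: nA.
have iMM i j : mu.-integrable D (EFin \o (fun x => M i j x * M i j x)).
  exact: (integrable_sqintM mD (sM i j) (sM i j)).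
have -> : (\int[mu]_(x in D) (norm2 (G x + Idn))%:E =
    (\sum_i \sum_j \int[mu]_(x in D) (M i j x * M i j x))%R%:E)%E.
  have iS i : mu.-integrable D (EFin \o (fun x => \sum_j M i j x * M i j x)).
    exact: integrable_sumr.
  have iSS : mu.-integrable D (EFin \o (fun x => \sum_i \sum_j M i j x * M i j x)).
    exact: integrable_sumr.
  transitivity (\int[mu]_(x in D) (\sum_i \sum_j M i j x * M i j x)%:E)%E.
    by apply: eq_integral => x _; congr _%:E.
  have -> : \sum_i \sum_j \int[mu]_(x in D) (M i j x * M i j x) =
      \int[mu]_(x in D) (\sum_i \sum_j M i j x * M i j x).
    by rewrite Rintegral_sum//; apply: eq_bigr => i _; rewrite Rintegral_sum.
  by rewrite /Rintegral fineK//; exact: (integrable_fin_num mD iSS).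
rewrite Rintegral_cst// mul1r.
have -> : \int[mu]_(x in D) \1_A x = fine (mu A).
  by rewrite /Rintegral integral_indic// setIC setIA setIid.
rewrite measureD//.
have -> : D `&` A = A by rewrite /A setIA setIid.
have fD : mu D \is a fin_num by rewrite ge0_fin_numE.
have fA : mu A \is a fin_num by rewrite ge0_fin_numE.
rewrite -[X in (_ <= _ + _ * X)%E]/(mu D - mu A)%E.
move: (\sum_i _) (mu D) (mu A) fD fA => s [a| |] [b| |] //= _ _ Hab.
rewrite -EFinB -!EFinM -!EFinD lee_fin mulrBr.
by move: Hab; move: (_ * a) (_ * b) (_ * a) => *; lra.
Qed.

Lemma minimizer_id : minimizer (n%:R ^+ 2) (fun x : 'cV[R]_n => Idn *m x) D.
Proof.
have -> : (fun x : 'cV[R]_n => Idn *m x) = id by apply/funext => x; rewrite mul1mx.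
split; first exact: H1_id.
move=> W _ HW; apply: le_trans (energy_competitor HW).
rewrite /J (integral_norm2_weak_gradient oD (is_weak_gradient_id mD)).
under eq_integral do rewrite norm2_scalar1.
rewrite integral_cst//; apply: leeD => //.
apply: lee_wpmul2l; first by rewrite lee_fin sqr_ge0.
apply: le_measure; rewrite ?inE//; apply: measurableI => //.
have -> : [set x : 'cV[R]_n | x != 0] = ~` [set 0].
  by apply/seteqP; split => x /eqP.
by apply: measurableC; exact: measurable_set1_cV.
Qed.

End bounded_domain.

Lemma H1loc_id : H1loc setT (fun x : 'cV[R]_n => x).
Proof.
have L K (m p : nat) (F : 'cV[R]_n -> 'M[R]_(m, p)) :
    (forall i j, continuous (fun x => F x i j)) -> compact K -> L2 K F.
  move=> cF cK; have [r [_ Kr]] := compact_sub_cbox cK.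
  exact: (continuous_L2 (compact_measurable_cV cK) Kr).
split.
  by move=> K cK _; apply: L => // i j; rewrite ord1; exact: coord_cV_continuous.
exists (fun=> Idn); first exact: is_weak_gradient_id.
by move=> K cK _; apply: L => // i j; exact: cst_continuous.
Qed.

Lemma global_minimizer_id : global_minimizer (n%:R ^+ 2) (fun x : 'cV[R]_n => Idn *m x).
Proof.
split; last first.
  move=> r r0; exact: minimizer_id (@open_Rd_ball R n r) (Rd_ball_sub_cbox r0).
have -> : (fun x : 'cV[R]_n => Idn *m x) = id by apply/funext => x; rewrite mul1mx.
exact: H1loc_id.
Qed.

Lemma Lambda_star_id_ge : ((n%:R ^+ 2)%:E <= Lambda_star Idn)%E.
Proof.
apply: ereal_sup_ubound => /=; exists (n%:R ^+ 2) => //; split.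
  by rewrite exprn_gt0// ltr0n.
exact: global_minimizer_id.
Qed.

End identity_minimizer.

Theorem theorem1p9 (R : realType) (d : nat) (hd : (3 <= d)%N) :
  (Lambda_star (1%:M : 'M[R]_d) - (norm2 (1%:M : 'M[R]_d))%:E >=
     ((d%:R - 1) ^+ 2 - d%:R)%:E)%E.
Proof.
rewrite norm2_scalar1 EFinB; apply: leeB => //.
apply: le_trans (Lambda_star_id_ge _); last exact: leq_trans hd.
have d1 : 1 <= d%:R :> R by rewrite ler1n (leq_trans _ hd).
by rewrite lee_fin ler_sqr ?nnegrE ?subr_ge0// gerBl.
Qed.
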